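(* Let $(X_i)_{i\ge1}$, $(Y_i)_{i\ge1}$ satisfy assumptions A1, A2 and A3 (stated in the context), with $\kappa>0$ the constant in A2 and $\gamma_0>0$ the constant in A3. Let $t(n)=n^{\beta}$ and $s(n)=n^{-c}$ with $0<\beta<\gamma_0/2$ and $\beta/\gamma_0<c<1/2$. Let $m\ge 4$ and $H_n=\frac{1}{\log\log n}$. Then, as $n\to\infty$, $$\left\|\frac{\widehat\zeta}{\widehat\rho}\,\mathbf 1_{\widehat\rho\ge H_n}-\gamma_X\right\|_{m/2}=O\left(\frac{1}{\log^{\kappa}n}\right).$$
   Context: Setting. $X_i$ are real random variables (''data'') and $Y_i$ are real random variables (''censoring times''). The tail function of a random variable $K$ is $P_K(x)=\mathrm{Prob}(K>x)$. For a real random variable $K$, $\|K\|_p=(\mathbf E|K|^p)^{1/p}$. A1: the $X_i$ are i.i.d., the $Y_i$ are i.i.d., and all the variables $X_i,Y_i$ are mutually independent. For all $x\ge a$ (some $a>0$), $P_X(x)=L_X(x)x^{-\alpha_X}$ and $P_Y(x)=L_Y(x)x^{-\alpha_Y}$, with $\alpha_X,\alpha_Y>0$ and $L_X,L_Y$ positive slowly varying functions at infinity. The tail indices are $\gamma_X=1/\alpha_X$, $\gamma_Y=1/\alpha_Y$. A2: $L_X,L_Y$ are differentiable on $(a,\infty)$ and there is $\kappa>0$ such that for $K=X,Y$, $\left|\frac{xL_K'(x)}{L_K(x)}\right|=O\left(\frac{1}{\log^{\kappa}x}\right)$ as $x\to\infty$. A3: there is a known constant $\gamma_0>0$ with $\gamma_X\ge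 2\gamma_0$ and $\gamma_Y\ge 2\gamma_0$. Observations and estimators. One observes $Z_i=\min(X_i,Y_i)$ and $\delta_i=\mathbf 1_{X_i\le Y_i}$ for $i=1,\dots,n$. For $x>0$, $$\widehat p(x)=\frac1n\sum_{i=1}^n\mathbf 1_{Z_i\ge x},\qquad \widehat q(x)=\frac1n\sum_{i=1}^n\delta_i\mathbf 1_{Z_i\ge x},$$ $$\widehat\rho=\frac{\widehat q(t(n))}{\widehat p(t(n))}\mathbf 1_{\widehat p(t(n))\ge s(n)},\qquad \widehat\zeta=\frac{\mathbf 1_{\widehat p(t(n))\ge s(n)}}{\widehat p(t(n))}\int_{t(n)}^\infty\frac{\widehat p(y)}{y}\,dy=\frac{\mathbf 1_{\widehat p(t(n))\ge s(n)}}{n\,\widehat p(t(n))}\sum_{i=1}^n\log\left(\frac{Z_i}{t(n)}\right)\mathbf 1_{Z_i\ge t(n)}.$$ Convention: $\infty\times0=0$, i.e. any expression multiplied by an indicator equal to $0$ is $0$. *)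

(* Defs.v *)
From HB Require Import structures.
From mathcomp Require Import all_boot all_order all_algebra.
From mathcomp Require Import all_classical all_reals all_analysis.
From mathcomp Require Import measurable_realfun.
Set Implicit Arguments.
Unset Strict Implicit.
Unset Printing Implicit Defensive.
Import Order.TTheory GRing.Theory Num.Theory.
Import numFieldNormedType.Exports.
Local Open Scope classical_set_scope.
Local Open Scope ring_scope.

Definition mutually_independent (d : measure_display) (T : measurableType d)
    (R : realType) (P : probability T R) (I : eqType) (W : I -> {RV P >-> R}) :=
  forall (J : seq I) (B : I -> set R), uniq J ->
    (forall i, i \in J -> measurable (B i)) ->
    (P (\big[setI/setT]_(i <- J) (W i @^-1` B i))
     = \prod_(i <- J) P (W i @^-1` B i))%E.

Definition identically_distributed (d : measure_display) (T : measurableType d)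
    (R : realType) (P : probability T R) (I : Type) (W : I -> {RV P >-> R}) :=
  forall (i j : I) (A : set R), measurable A ->
    distribution P (W i) A = distribution P (W j) A.

Definition joint_family (A : Type) (X Y : nat -> A) (k : nat + nat) : A :=
  match k with inl i => X i | inr i => Y i end.

Definition slowly_varying (R : realType) (L : R -> R) :=
  forall lambda : R, 0 < lambda -> L (lambda * x) / L x @[x --> +oo] --> (1 : R).

(* [L] is a total function, but only its values on [a, +oo[ are constrained. *)
Definition regularly_varying_tail (d : measure_display) (T : measurableType d)
    (R : realType) (P : probability T R) (K : {RV P >-> R})
    (a alpha : R) (L : R -> R) :=
  [/\ forall x, a <= x -> 0 < L x,
      slowly_varying L
    & forall x, a <= x -> ccdf K x = (L x * x `^ (- alpha))%:E].

Definition log_smooth (R : realType) (a kappa : R) (L : R -> R) :=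
  (forall x, a < x -> derivable L x 1) /\
  exists C : R, \forall x \near +oo,
    `|x * derive1 L x / L x| <= C / ln x `^ kappa.

(* The sample of size [n] is indexed by 0, ..., n - 1. The thresholds [t] and
   [s] are the values t(n) and s(n). *)
Section estimators.
Context {R : realType} {T : Type} (X Y : nat -> T -> R).

Definition obs (i : nat) (w : T) : R := Num.min (X i w) (Y i w).

Definition uncensored (i : nat) (w : T) : bool := X i w <= Y i w.

Definition phat (n : nat) (x : R) (w : T) : R :=
  n%:R^-1 * \sum_(i < n) (x <= obs i w)%R%:R.

Definition qhat (n : nat) (x : R) (w : T) : R :=
  n%:R^-1 * \sum_(i < n) (uncensored i w)%:R * (x <= obs i w)%R%:R.

Definition rhohat (n : nat) (t s : R) (w : T) : R :=
  qhat n t w / phat n t w * (s <= phat n t w)%R%:R.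

Definition zetahat (n : nat) (t s : R) (w : T) : R :=
  (s <= phat n t w)%R%:R / phat n t w *
  \int[lebesgue_measure]_(y in `[t, +oo[) (phat n y w / y).

(* Since 0^-1 = 0, the convention oo * 0 = 0 holds for every expression
   multiplied by a vanishing indicator. *)
Definition gammahat (n : nat) (t s h : R) (w : T) : R :=
  zetahat n t s w / rhohat n t s w * (h <= rhohat n t s w)%R%:R.

End estimators.

Section zetahat_sum.
Context {R : realType} {T : Type} (X Y : nat -> T -> R).
Local Notation mu := (@lebesgue_measure R).

Lemma continuous_inv_within (t z : R) : 0 < t ->
  {within `[t, z], continuous (fun y : R => y^-1)}.
Proof.
move=> t0; apply: continuous_in_subspaceT => y.
rewrite inE /= in_itv/= => /andP[ty _].
by apply: inv_continuous; rewrite gt_eqF// (lt_le_trans t0).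
Qed.

Lemma integral_inv (t z : R) : 0 < t -> t <= z ->
  (\int[mu]_(y in `[t, z]) (y^-1)%:E = (ln (z / t))%:E)%E.
Proof.
move=> t0; rewrite le_eqVlt => /predU1P[<-|tz].
  by rewrite set_itv1 integral_set1 divff ?gt_eqF// ln1.
rewrite (@continuous_FTC2 _ (fun y => y^-1) (@ln R))//.
- by rewrite ln_div ?posrE// (lt_trans t0).
- exact: continuous_inv_within.
- split.
  + move=> y; rewrite in_itv/= => /andP[ty _].
    by have [] := is_derive1_ln (lt_trans t0 ty).
  + by apply: cvg_at_right_filter; apply: continuous_ln.
  + by apply: cvg_at_left_filter; apply: continuous_ln; rewrite (lt_trans t0).
- move=> y; rewrite in_itv/= => /andP[ty _].
  by rewrite derive1E; have [_ ->] := is_derive1_ln (lt_trans t0 ty).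
Qed.

Lemma integral_inv_tail (t z : R) : 0 < t ->
  (\int[mu]_(y in `[t, +oo[) ((y <= z)%R%:R / y)%:E
   = (ln (z / t) * (t <= z)%R%:R)%:E)%E.
Proof.
move=> t0; have [tz|zt] := leP t z; last first.
  rewrite mulr0; apply: integral0_eq => y /=.
  rewrite in_itv/= andbT => ty.
  by rewrite leNgt (lt_le_trans zt ty) mul0r.
rewrite mulr1 -integral_inv//.
have -> : [set` `[t, z]] = `[t, +oo[ `&` [set y | y <= z]%R :> set R.
  by apply/seteqP; split => y /=; rewrite !in_itv/= andbT => /andP.
rewrite integral_mkcondr; apply: eq_integral => y _.
rewrite patchE; case: ifPn => [|].
  by rewrite inE/= => ->; rewrite mul1r.
by rewrite notin_setE/= => /negP/negbTE ->; rewrite mul0r.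
Qed.

Lemma measurable_inv_tail (t z : R) : 0 < t ->
  measurable_fun (`[t, +oo[ : set R) (fun y : R => (y <= z)%R%:R / y).
Proof.
move=> t0; apply: measurable_funM.
  have -> : (fun y : R => (y <= z)%R%:R) = \1_`]-oo, z] :> (R -> R).
    by apply/funext => y; rewrite indicE mem_setE in_itv.
  exact: measurable_indic.
apply: subspace_continuous_measurable_fun => //.
apply: continuous_in_subspaceT => y.
rewrite inE /= in_itv/= andbT => ty.
by apply: inv_continuous; rewrite gt_eqF// (lt_le_trans t0).
Qed.

Lemma zetahatE (n : nat) (t s : R) (w : T) : 0 < t ->
  zetahat X Y n t s w =
  (s <= phat X Y n t w)%R%:R / (n%:R * phat X Y n t w) *
  \sum_(i < n) ln (obs X Y i w / t) * (t <= obs X Y i w)%R%:R.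
Proof.
move=> t0; rewrite /zetahat.
suff -> : \int[mu]_(y in `[t, +oo[) (phat X Y n y w / y) =
  n%:R^-1 * \sum_(i < n) ln (obs X Y i w / t) * (t <= obs X Y i w)%R%:R.
  by rewrite mulrA; congr (_ * _); rewrite (invfM n%:R) mulrA mulrAC.
rewrite /Rintegral.
under eq_integral => y _.
  rewrite /phat -mulrA mulr_suml EFinM -sumEFin.
  over.
have ge0 (z y : R) : [set` `[t, +oo[] y -> (0 <= ((y <= z)%R%:R / y)%:E)%E.
  rewrite /= in_itv/= andbT => ty; rewrite lee_fin divr_ge0//.
  by rewrite (le_trans _ ty)// ltW.
rewrite ge0_integralZl_EFin//; last first.
- by apply: emeasurable_sum => i; apply/measurable_EFinP; exact: measurable_inv_tail.
- by move=> y ty; apply: sume_ge0 => i _; exact: ge0.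
rewrite ge0_integral_sum//=; last first.
- by move=> i y ty; exact: ge0.
- by move=> i; apply/measurable_EFinP; exact: measurable_inv_tail.
under eq_bigr do rewrite integral_inv_tail//.
by rewrite sumEFin -EFinM.
Qed.

End zetahat_sum.

(* Main.v *)
Require Import Defs.
From HB Require Import structures.
From mathcomp Require Import all_boot all_order all_algebra.
From mathcomp Require Import all_classical all_reals all_analysis.
From mathcomp Require Import measurable_realfun.
From mathcomp Require Import ring lra.
Import Order.TTheory GRing.Theory Num.Theory.
Import numFieldNormedType.Exports.
Local Open Scope classical_set_scope.
Local Open Scope ring_scope.
Set Implicit Arguments.
Unset Strict Implicit.
Unset Printing Implicit Defensive.

(** Write [t], [s], [h] for the thresholds t(n), s(n), H_n. As soon as both
indicators are 1, the estimator is the ratio of the sample means of the log-excess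
ln (Z / t) 1(Z >= t) and of the failure indicator delta 1(Z >= t). Subtracting
1 / alphaX turns the numerator into the sample mean of the score
<<
  alphaX * ln (Z / t) * 1(Z >= t) - delta * 1(Z >= t)
>>
([gammahat_errorE]), so everything rests on the score being almost centered.
If X had an exact power tail, then ln (X / t) given X >= t would be an exponential
variable N of rate alphaX, and alphaX * E(min(N, u)) = Prob(N <= u) for every u:
given the censoring time, the score would have mean zero. Here the exponent of the
tail beyond t is known up to an error e = C / ln t ^ kappa
([power_decay_survival]), and comparing increments shows that the identity holds up
to the relative error e ([truncated_mean_bias], [score_bias]). As ln t(n) is
beta * ln n, this bias is the announced rate.

All the other errors are smaller by a power of n. The probabilities that an
observation exceeds t, and that it does so uncensored, are comparable and at least
of order n ^ (- beta * b), for any b > alphaX + alphaY ([population_regime]); b can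
be chosen with beta * b < c < 1/2. The fluctuations of sample means are of order
n ^ (- 1/2) and, by independence, have exponential moments bounded uniformly in n
([exp_moment_fluctuation]), because the score itself has one: the excess is
dominated by an exponential variable ([exp_moment_excess]). When the scaled
fluctuations are at most half of n ^ (1/2 - c), the denominators are at least half
their expectations. Otherwise either an indicator vanishes, and the error is
1 / alphaX, or the two indicators bound the denominator below by h * s; the power of
n lost in this way is repaid by a large power of 2 * fluctuation / n ^ (1/2 - c),
which then exceeds 1. Hence the error is at most
1 / ln n ^ kappa times a polynomial in the fluctuations ([error_bound]), and all
moments of that polynomial are bounded. *)

(** * Independence and product laws *)

Section joint_law.
Context {R : realType} d d1 d2 (T : measurableType d)
  (T1 : measurableType d1) (T2 : measurableType d2).
Context (Q : {measure set T -> \bar R}) (U : {mfun T >-> T1})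
  (V : {mfun T >-> T2}) (m1 : probability T1 R) (m2 : probability T2 R).

(** Rectangles determine the law of a pair. The constant [c] is the mass left when
[Q] is the restriction of a probability to an event independent of the pair. *)
Lemma joint_law (c : {nonneg R}) :
  (forall A B, measurable A -> measurable B ->
    Q (U @^-1` A `&` V @^-1` B) = (c%:num%:E * (m1 A * m2 B))%E) ->
  forall D, measurable D ->
    Q ((fun w => (U w, V w)) @^-1` D) = (c%:num%:E * (m1 \x m2) D)%E.
Proof.
move=> rect D mD.
have mUV : measurable_fun setT (fun w => (U w, V w)).
  exact: measurable_fun_pair.
have [c0|c0] := eqVneq (c%:num : R) 0.
  rewrite c0 mul0e; apply/eqP; rewrite -measure_le0.
  have := rect setT setT measurableT measurableT.
  rewrite c0 mul0e !preimage_setT setTI => <-.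
  by rewrite le_measure// inE//; rewrite -[X in measurable X]setTI; exact: mUV.
have cV0 : 0 < (c%:num : R)^-1 by rewrite invr_gt0 lt_neqAle eq_sym c0 /=.
pose m' := mscale (NngNum (ltW cV0))
  (measure_function_pushforward__canonical__measure_function_Measure Q mUV).
rewrite (@product_measure_unique _ _ _ _ _ m1 m2 m')//.
  by rewrite /m' /mscale /= /pushforward muleA -EFinM mulfV// mul1e.
move=> A B mA mB; rewrite /m' /mscale /= /pushforward.
transitivity ((c%:num^-1)%:E * Q (U @^-1` A `&` V @^-1` B))%E => //.
by rewrite rect// muleA -EFinM mulVf// mul1e.
Qed.

End joint_law.

Section adding_a_pair.
Context {R : realType} d (T : measurableType d) (P : probability T R)
  (I : eqType) (W : I -> {RV P >-> R}).

Definition cylinder (J : seq I) (B : I -> set R) : set T :=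
  \big[setI/setT]_(i <- J) (W i @^-1` B i).

(** Independence on rectangles, the form in which the mutual independence of a
family is given. In the induction on the sample size, [S] is a partial sum and [J]
lists variables still to come. *)
Definition independent_of (J : seq I) (S : {RV P >-> R}) :=
  forall A B, measurable A -> (forall i, measurable (B i)) ->
    P (S @^-1` A `&` cylinder J B)
    = (P (S @^-1` A) * \prod_(i <- J) P (W i @^-1` B i))%E.

Lemma measurable_cylinder J B :
  (forall i, measurable (B i)) -> measurable (cylinder J B).
Proof.
move=> mB; rewrite /cylinder; elim/big_ind : _ => //.
- exact: measurableI.
- by move=> i _; exact: measurable_funPTI.
Qed.

Lemma cylinder_setT J : cylinder J (fun=> setT) = setT.
Proof. by rewrite /cylinder big1// => i _; rewrite preimage_setT. Qed.

Variables (i j : I) (J : seq I) (S : {RV P >-> R}).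
Hypothesis uJ : uniq [:: i, j & J].
Hypothesis SJ : independent_of [:: i, j & J] S.
Let law : probability (R * R)%type R :=
  (distribution P (W i) \x distribution P (W j))%E.
Let pair_fun := fun w => (W i w, W j w).
Let mpair : measurable_fun setT pair_fun.
Proof. exact: measurable_fun_pair. Qed.
HB.instance Definition _ := isMeasurableFun.Build _ _ _ _ pair_fun mpair.
Let pair : {mfun T >-> (R * R)%type} := pair_fun.

Let prob_num (p : \bar R) : (0 <= p -> p \is a fin_num ->
  exists c : {nonneg R}, p = c%:num%:E)%E.
Proof.
move=> p0 pf; have f0 : 0 <= fine p by exact: fine_ge0.
by exists (NngNum f0); rewrite /= fineK.
Qed.

Let prod_num B : (forall i, measurable (B i)) ->
  exists c : {nonneg R}, (\prod_(k <- J) P (W k @^-1` B k))%E = c%:num%:E.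
Proof.
move=> mB; elim/big_ind : _.
- by exists 1%:nng.
- move=> x y [c ->] [e ->].
  have ce0 : 0 <= c%:num * e%:num :> R by rewrite mulr_ge0.
  by exists (NngNum ce0); rewrite -EFinM.
- move=> k _; apply: prob_num => //.
  by apply: fin_num_measure; exact: measurable_funPTI.
Qed.

Let SA_num A : measurable A -> exists c : {nonneg R}, P (S @^-1` A) = c%:num%:E.
Proof.
move=> mA; apply: prob_num => //.
by apply: fin_num_measure; exact: measurable_funPTI.
Qed.

(** Splitting off the pair: the rectangle in [W i] and [W j] is a cylinder on the
longer list. *)
Let law_pair A B D : measurable A -> (forall i, measurable (B i)) ->
  measurable D ->
  P (S @^-1` A `&` pair @^-1` D `&` cylinder J B)
  = ((\prod_(k <- J) P (W k @^-1` B k)) * (P (S @^-1` A) * law D))%E.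
Proof.
move=> mA mB mD.
have mE : measurable (S @^-1` A `&` cylinder J B).
  by apply: measurableI; [exact: measurable_funPTI|exact: measurable_cylinder].
have [e eE] := prod_num mB; have [p pE] := SA_num mA.
have pe0 : 0 <= p%:num * e%:num :> R by rewrite mulr_ge0.
pose c := NngNum pe0.
have := @joint_law R _ _ _ T _ _ (mrestr P mE) (W i) (W j)
  (distribution P (W i)) (distribution P (W j)) c.
rewrite /mrestr => law_D.
transitivity (P (pair @^-1` D `&` (S @^-1` A `&` cylinder J B))).
  by congr (P _); rewrite setIA [pair @^-1` D `&` _]setIC.
transitivity (c%:num%:E * law D)%E; last first.
  by rewrite pE eE /= EFinM (muleC p%:num%:E) -muleA.
apply: law_D => // B1 B2 mB1 mB2.
pose B' k := if k == i then B1 else if k == j then B2 else B k.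
have := @SJ A B' mA.
have B'J k : k \in J -> B' k = B k.
  move=> kJ; rewrite /B'; move: uJ; rewrite /= inE negb_or -!andbA.
  case/and4P => _ iJ jJ _.
  case: eqP => [ki|_]; first by rewrite -ki kJ in iJ.
  by case: eqP => [kj|_//]; rewrite -kj kJ in jJ.
have ij : (j == i) = false.
  by move: uJ; rewrite /= inE negb_or eq_sym; case: eqP.
have Bi : B' i = B1 by rewrite /B' eqxx.
have Bj : B' j = B2 by rewrite /B' ij eqxx.
rewrite /cylinder !big_cons Bi Bj.
rewrite (eq_big_seq (fun k => W k @^-1` B k)); last first.
  by move=> k kJ; rewrite B'J.
rewrite (eq_big_seq (fun k => P (W k @^-1` B k))); last first.
  by move=> k kJ; rewrite B'J.
move=> H.
transitivity (P (W i @^-1` B1 `&` W j @^-1` B2 `&`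
  (S @^-1` A `&` cylinder J B))) => //.
rewrite (_ : _ `&` (S @^-1` A `&` _) = S @^-1` A `&` (W i @^-1` B1 `&`
    (W j @^-1` B2 `&` cylinder J B))); last by rewrite setICA -!setIA.
rewrite H; last by move=> k; rewrite /B'; case: ifP => // _; case: ifP.
by rewrite pE eE EFinM /distribution /pushforward -!muleA;
  congr (_ * _)%E; rewrite muleA muleC.
Qed.

(** On any event of the remaining variables, the state and the new pair have a
product law. *)
Let law_triple B D : (forall i, measurable (B i)) -> measurable D ->
  P ((fun w => (S w, pair w)) @^-1` D `&` cylinder J B)
  = ((\prod_(k <- J) P (W k @^-1` B k)) * (distribution P S \x law) D)%E.
Proof.
move=> mB mD; have [e eE] := prod_num mB.
have mE := measurable_cylinder J mB.
transitivity (e%:num%:E * (distribution P S \x law) D)%E; last by rewrite eE.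
apply: (@joint_law R _ _ _ T _ _ (mrestr P mE) S pair
  (distribution P S) law e _ D mD) => A C mA mC.
transitivity (P (S @^-1` A `&` pair @^-1` C `&` cylinder J B)) => //.
by rewrite law_pair// eE.
Qed.

Let law_triple0 D : measurable D ->
  P ((fun w => (S w, pair w)) @^-1` D) = (distribution P S \x law)%E D.
Proof.
move=> mD; have := @law_triple (fun=> setT) D (fun=> measurableT) mD.
rewrite cylinder_setT setIT big1 ?mul1e// => k _.
by rewrite preimage_setT probability_setT.
Qed.

Variable f : R * R -> R.
Hypothesis mf : measurable_fun setT f.
Let mSf : measurable_fun setT (fun w => S w + f (W i w, W j w)).
Proof.
by apply: measurable_funD => //; exact: (measurableT_comp mf).
Qed.
Let Sf : {RV P >-> R} := HB.pack (fun w => S w + f (W i w, W j w))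
  (isMeasurableFun.Build _ _ _ _ _ mSf).

(** The new partial sum is a function of the state and of the pair, whose joint law
on an event of the remaining variables is a fixed law times the mass of that
event. *)
Lemma independent_of_add : independent_of J Sf.
Proof.
move=> A B mA mB.
pose D := (fun z : R * (R * R) => z.1 + f z.2) @^-1` A.
have mD : measurable D.
  rewrite -[D]setTI; apply: (_ : measurable_fun _ _) => //.
  apply: measurable_funD; first exact: measurable_fst.
  exact: (measurableT_comp mf measurable_snd).
have -> : Sf @^-1` A = (fun w => (S w, pair w)) @^-1` D by [].
by rewrite law_triple// law_triple0// muleC.
Qed.

Lemma expectation_exp_add :
  (\int[P]_w (expR (Sf w))%:E
   = \int[P]_w (expR (S w))%:E * \int[law]_z (expR (f z))%:E)%E.
Proof.
have mtriple : measurable_fun setT (fun w => (S w, pair w)).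
  exact: measurable_fun_pair.
pose triple : {mfun T >-> (R * (R * R))%type} :=
  HB.pack (fun w => (S w, pair w)) (isMeasurableFun.Build _ _ _ _ _ mtriple).
have mg : measurable_fun setT
    (fun z : R * (R * R) => (expR (z.1) * expR (f z.2))%:E).
  apply/measurable_EFinP; apply: measurable_funM.
    exact: (measurableT_comp (@measurable_expR R) measurable_fst).
  apply: measurableT_comp => //.
  exact: (measurableT_comp mf measurable_snd).
have mexpf : measurable_fun setT (fun z => (expR (f z))%:E).
  by apply/measurable_EFinP; exact: measurableT_comp.
have -> : (\int[P]_w (expR (Sf w))%:E =
    \int[distribution P triple]_z (expR z.1 * expR (f z.2))%:E)%E.
  rewrite ge0_integral_distribution//.
  by apply: eq_integral => w _ /=; rewrite expRD.
transitivity (\int[distribution P S \x law]_z (expR z.1 * expR (f z.2))%:E)%E.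
  have H D : measurable D -> D `<=` setT ->
      distribution P triple D = (distribution P S \x law)%E D.
    by move=> mD _; rewrite -law_triple0.
  by rewrite (eq_measure_integral _ H).
rewrite fubini_tonelli1//.
rewrite /fubini_F /=.
under eq_integral => s _.
  under eq_integral do rewrite EFinM.
  rewrite ge0_integralZl//.
  over.
rewrite ge0_integralZr//; last 2 first.
- by apply/measurable_EFinP; exact: measurable_expR.
- by apply: integral_ge0 => z _; rewrite lee_fin expR_ge0.
rewrite ge0_integral_distribution//.
by apply/measurable_EFinP; exact: measurable_expR.
Qed.

End adding_a_pair.

(** * Exponential moments of sample means *)

Section sample_sums.
Context {R : realType} d (T : measurableType d) (P : probability T R)
  (X Y : nat -> {RV P >-> R}).

Definition pair_law := (distribution P (X 0%N) \x distribution P (Y 0%N))%E.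
HB.instance Definition _ := Probability.on pair_law.

Hypotheses (X_id : identically_distributed X) (Y_id : identically_distributed Y)
  (XY_indep : mutually_independent (joint_family X Y)).

Definition pair_sum (f : R * R -> R) n w := \sum_(i < n) f (X i w, Y i w).

Lemma measurable_pair_sum (f : R * R -> R) n :
  measurable_fun setT f -> measurable_fun setT (pair_sum f n).
Proof.
move=> mf; apply: measurable_sum => i.
by apply: (measurableT_comp mf); exact: measurable_fun_pair.
Qed.

Let law_id i D : measurable D ->
  (distribution P (X i) \x distribution P (Y i))%E D = pair_law D.
Proof.
move=> mD; apply: product_measure_unique mD => A B mA mB.
transitivity ((distribution P (X 0%N) \x distribution P (Y 0%N))%E (A `*` B)) => //.
rewrite product_measure1E//.
by congr (_ * _)%E; [exact: X_id|exact: Y_id].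
Qed.

(** The induction carries along that the partial sum is independent of all
variables of index at least [n], so that the next pair can be split off. *)
Lemma expectation_exp_sum (f : R * R -> R) n : measurable_fun setT f ->
  (\int[P]_w (expR (pair_sum f n w))%:E
   = (\int[pair_law]_z (expR (f z))%:E) ^+ n)%E.
Proof.
move=> mf.
pose later k (i : nat + nat) := match i with inl i | inr i => (k <= i)%N end.
suff H : forall (S : {RV P >-> R}), S =1 pair_sum f n ->
    (forall J, uniq J -> all (later n) J ->
      independent_of (joint_family X Y) J S) /\
    (\int[P]_w (expR (S w))%:E = (\int[pair_law]_z (expR (f z))%:E) ^+ n)%E.
  pose S : {RV P >-> R} := HB.pack (pair_sum f n)
    (isMeasurableFun.Build _ _ _ _ _ (measurable_pair_sum n mf)).
  by have [] := H S (fun=> erefl).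
elim: n => [|n IH] S SE.
  have S0 w : S w = 0 by rewrite SE /pair_sum big_ord0.
  split; last first.
    rewrite expe0; under eq_integral do rewrite S0 expR0.
    by rewrite integral_cst// mul1e; exact: probability_setT.
  move=> J uJ _ A B mA mB; have [A0|A0] := pselect (A 0).
    have -> : S @^-1` A = setT by apply/seteqP; split => // w _ /=; rewrite S0.
    by rewrite setTI (probability_setT P) mul1e; exact: XY_indep.
  have -> : S @^-1` A = set0 by apply/seteqP; split => // w /=; rewrite S0.
  by rewrite set0I measure0 mul0e.
pose S' : {RV P >-> R} := HB.pack (pair_sum f n)
    (isMeasurableFun.Build _ _ _ _ _ (measurable_pair_sum n mf)).
have [S'J S'E] := IH S' (fun=> erefl).
have SS' w : S w = S' w + f (X n w, Y n w).
  by rewrite SE /pair_sum big_ord_recr.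
have laterW J : uniq J -> all (later n.+1) J ->
    independent_of (joint_family X Y) [:: inl n, inr n & J] S' /\
    uniq [:: inl n, inr n & J].
  move=> uJ /allP lJ.
  have u : uniq [:: inl n, inr n & J].
    rewrite /= inE /= uJ andbT; apply/andP; split; apply/negP => /lJ /=;
    by rewrite ltnn.
  split => //; apply: S'J => //=; rewrite leqnn/=.
  by apply/allP => -[] i /lJ /= /ltnW.
split.
  move=> J uJ lJ A B mA mB; have [iS' u] := laterW J uJ lJ.
  have := independent_of_add u iS' mf mA mB.
  have -> // : S @^-1` A = (fun w => S' w + f (X n w, Y n w)) @^-1` A.
  by apply/seteqP; split => w /=; rewrite SS'.
have [iS' u] := laterW [::] isT isT.
rewrite expeS -S'E muleC; under eq_integral do rewrite SS'.
have := expectation_exp_add u iS' mf => /= ->.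
by congr (_ * _)%E; apply: eq_measure_integral => D mD _; exact: law_id.
Qed.

End sample_sums.

Section exponential_inequalities.
Context {R : realType}.

(** Up to [1/2] this comes from inverting [1 - x <= expR (- x)]; beyond, the last
term alone is at least the left-hand side. *)
Lemma expR_le_quadratic (x : R) : expR x <= 1 + x + 4 * x ^+ 2 * expR `|x|.
Proof.
have h (y : R) : y < 1 -> expR y <= (1 - y)^-1.
  move=> y1; rewrite -(invrK (expR y)) lef_pV2 ?posrE ?invr_gt0 ?expR_gt0 ?subr_gt0//.
  by rewrite -expRN expR_ge1Dx.
have e1 : 1 <= expR `|x| by rewrite -expR0 ler_expR.
have x2 : 0 <= x ^+ 2 by exact: sqr_ge0.
have [x0|x0] := leP x 0.
  have : expR x <= 1 + x + x ^+ 2.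
    apply: le_trans (h x _) _; first by lra.
    have d : 0 < 1 - x by lra.
    by rewrite -(ler_pM2r d) mulVf ?gt_eqF//; nra.
  by move=> /le_trans; apply; nra.
have [x1|x1] := leP x 2^-1.
  have : expR x <= 1 + x + 2 * x ^+ 2.
    apply: le_trans (h x _) _; first by lra.
    have d : 0 < 1 - x by lra.
    by rewrite -(ler_pM2r d) mulVf ?gt_eqF//; nra.
  by move=> /le_trans; apply; nra.
rewrite (ger0_norm (ltW x0)).
have := expR_ge0 x.
have : 1 <= 4 * x ^+ 2 by nra.
nra.
Qed.

Lemma sqr_le_expR (y : R) : y ^+ 2 <= 16 * expR (`|y| / 2).
Proof.
have -> : `|y| / 2 = `|y| / 4 + `|y| / 4 by field.
rewrite expRD -(real_normK (num_real y)).
have := expR_ge1Dx (`|y| / 4); have := normr_ge0 y; nra.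
Qed.

(** Half of the exponent pays for [`|u * g|] and the other half for [g ^+ 2]. *)
Lemma expR_scaled_le (u g : R) : `|u| <= 2^-1 ->
  expR (u * g) <= 1 + u * g + 64 * u ^+ 2 * expR `|g|.
Proof.
move=> u2; apply: le_trans (expR_le_quadratic _) _.
rewrite lerD2l exprMn.
have -> : 4 * (u ^+ 2 * g ^+ 2) * expR `|u * g|
    = u ^+ 2 * (4 * (g ^+ 2 * expR `|u * g|)) by ring.
have -> : 64 * u ^+ 2 * expR `|g| = u ^+ 2 * (4 * (16 * expR `|g|)) by ring.
rewrite ler_wpM2l ?sqr_ge0// ler_pM2l//.
have -> : expR `|g| = expR (`|g| / 2) * expR (`|g| / 2).
  by rewrite -expRD; congr expR; field.
rewrite mulrA ler_pM ?sqr_ge0 ?expR_ge0 ?sqr_le_expR// ler_expR normrM.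
by rewrite mulrC; rewrite ler_wpM2l.
Qed.

End exponential_inequalities.

Section centered_moment.
Context {R : realType} d (S : measurableType d) (m : probability S R)
  (f : S -> R) (K : R).
Hypotheses (mf : measurable_fun setT f)
  (fK : (\int[m]_z (expR `|f z|)%:E <= K%:E)%E).

Let mexp : measurable_fun setT (fun z => (expR `|f z|)%:E).
Proof.
apply/measurable_EFinP; apply: measurableT_comp => //.
exact: measurableT_comp.
Qed.

Lemma integrable_exp_abs : m.-integrable setT (fun z => (expR `|f z|)%:E).
Proof.
apply/integrableP; split=> //.
under eq_integral do rewrite gee0_abs ?lee_fin ?expR_ge0//.
exact: le_lt_trans fK (ltry _).
Qed.

Lemma integrable_of_exp : m.-integrable setT (EFin \o f).
Proof.
apply: le_integrable integrable_exp_abs => //; first exact/measurable_EFinP.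
move=> z _ /=; rewrite lee_fin (ger0_norm (expR_ge0 _)).
by apply: le_trans (expR_ge1Dx _); rewrite lerDr.
Qed.

Lemma abs_mean_le : `|\int[m]_z f z| <= K.
Proof.
rewrite -lee_fin EFin_normr_Rintegral//; last exact: integrable_of_exp.
apply: le_trans fK; apply: le_trans (le_abse_integral _ _ _) _ => //.
  exact/measurable_EFinP.
apply: ge0_le_integral => //.
- by apply/measurable_EFinP; exact: measurableT_comp.
- move=> z _ /=; rewrite lee_fin.
  by apply: le_trans (expR_ge1Dx _); rewrite lerDr.
Qed.

(** The linear term of the exponential integrates to zero, so that the deviation
from one is of second order in the scale [u]. *)
Lemma exp_moment_centered (u : R) : `|u| <= 2^-1 ->
  (\int[m]_z (expR (u * (f z - \int[m]_y f y)))%:E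
   <= (1 + 64 * u ^+ 2 * (K * expR K))%:E)%E.
Proof.
move=> u2; set M := \int[m]_y f y.
have K0 : 0 <= K by exact: le_trans abs_mean_le.
have mg : measurable_fun setT (fun z => u * (f z - M)).
  by apply: measurable_funM => //; apply: measurable_funB.
have intf := integrable_of_exp; have inte := integrable_exp_abs.
have bound z : expR (u * (f z - M)) <=
    (1 - u * M) + u * f z + 64 * u ^+ 2 * expR K * expR `|f z|.
  apply: le_trans (expR_scaled_le _ u2) _.
  have -> : 1 + u * (f z - M) = 1 - u * M + u * f z by ring.
  rewrite lerD2l -[leRHS]mulrA -expRD; apply: ler_wpM2l.
    by rewrite mulr_ge0// sqr_ge0.
  rewrite ler_expR (le_trans (ler_normB _ _))// addrC lerD2r.
  exact: abs_mean_le.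
apply: (@le_trans _ _ (\int[m]_z
    ((1 - u * M)%:E + u%:E * (f z)%:E
     + (64 * u ^+ 2 * expR K)%:E * (expR `|f z|)%:E))%E).
  apply: ge0_le_integral => //.
  - by apply/measurable_EFinP; exact: measurableT_comp.
  - apply: emeasurable_funD; last exact: measurable_funeM.
    by apply: emeasurable_funD => //; apply: measurable_funeM; exact/measurable_EFinP.
  - by move=> z _; rewrite lee_fin.
rewrite integralD//=; last 2 first.
- by apply: integrableD => //; [exact: finite_measure_integrable_cst|exact: integrableZl].
- exact: integrableZl.
rewrite integralD//=; last 2 first.
- exact: finite_measure_integrable_cst.
- exact: integrableZl.
have -> : (\int[m]_x (1 - u * M)%:E = (1 - u * M)%:E)%E.
  by rewrite integral_cst// -[RHS]mule1; congr (_ * _)%E; exact: probability_setT.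
rewrite !integralZl//.
have -> : (\int[m]_z (f z)%:E = M%:E)%E.
  by rewrite /M /Rintegral fineK//; exact: integrable_fin_num.
rewrite -EFinM -EFinD.
rewrite (_ : 1 - u * M + u * M = 1); last by ring.
rewrite [in leRHS]EFinD leeD2l//.
rewrite (_ : 64 * u ^+ 2 * (K * expR K) = 64 * u ^+ 2 * expR K * K); last by ring.
rewrite [in leRHS]EFinM; apply: lee_wpmul2l => //.
by rewrite lee_fin mulr_ge0 ?expR_ge0// mulr_ge0 ?sqr_ge0.
Qed.

End centered_moment.

Section sample_mean_moment.
Context {R : realType} d (T : measurableType d) (P : probability T R)
  (X Y : nat -> {RV P >-> R}).
Hypotheses (X_id : identically_distributed X) (Y_id : identically_distributed Y)
  (XY_indep : mutually_independent (joint_family X Y)).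

Definition fluctuation (f : R * R -> R) n w : R :=
  Num.sqrt n%:R *
  (n%:R^-1 * pair_sum X Y f n w - \int[pair_law X Y]_z f z).

Lemma measurable_fluctuation (f : R * R -> R) n :
  measurable_fun setT f -> measurable_fun setT (fluctuation f n).
Proof.
move=> mf; apply: measurable_funM => //; apply: measurable_funB => //.
by apply: measurable_funM => //; exact: measurable_pair_sum.
Qed.

(** By independence the moment generating function of the sum is a power, and
each factor is at most one plus a constant over [n]. The scale [1 / sqrt n] is at
most one half when [n] is at least 4. *)
Lemma exp_moment_fluctuation (f : R * R -> R) K n :
  measurable_fun setT f ->
  (\int[pair_law X Y]_z (expR `|f z|)%:E <= K%:E)%E -> (4 <= n)%N ->
  (\int[P]_w (expR `|fluctuation f n w|)%:E
   <= (2 * expR (64 * (K * expR K)))%:E)%E.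
Proof.
move=> mf fK n4; set M := \int[pair_law X Y]_z f z.
have n0 : 0 < n%:R :> R by rewrite ltr0n; case: n n4.
have s0 : 0 < Num.sqrt n%:R :> R by rewrite sqrtr_gt0.
have s2 : 2 <= Num.sqrt n%:R :> R.
  by rewrite -[leLHS]ger0_norm// -sqrtr_sqr ler_wsqrtr// -natrX ler_nat.
set u : R := (Num.sqrt n%:R)^-1.
have u2n : n%:R * u ^+ 2 = 1.
  by rewrite exprVn sqr_sqrtr ?ltW// mulfV// gt_eqF.
have sE : Num.sqrt n%:R * n%:R^-1 = u.
  by rewrite -{2}(sqr_sqrtr (ltW n0)) expr2 invfM mulrA mulfV ?mul1r ?gt_eqF.
have sE' : u * n%:R = Num.sqrt n%:R.
  by rewrite -sE -mulrA mulVf ?mulr1 ?gt_eqF.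
have fluctE w : fluctuation f n w = pair_sum X Y (fun z => u * (f z - M)) n w.
  rewrite /fluctuation -/M /pair_sum -mulr_sumr sumrB sumr_const card_ord.
  by rewrite -[M *+ n]mulr_natl mulrBr mulrA sE -sE' mulrBr mulrA.
have one (v : R) : `|v| <= 2^-1 -> n%:R * v ^+ 2 = 1 ->
    (\int[P]_w (expR (pair_sum X Y (fun z => v * (f z - M)) n w))%:E
     <= (expR (64 * (K * expR K)))%:E)%E.
  move=> v2 nv2.
  have mg : measurable_fun setT (fun z => v * (f z - M)).
    by apply: measurable_funM => //; apply: measurable_funB.
  rewrite expectation_exp_sum//.
  have h := exp_moment_centered mf fK v2.
  have K0 : 0 <= K by exact: le_trans (abs_mean_le mf fK).
  have [r rE] : exists r, (\int[pair_law X Y]_z (expR (v * (f z - M)))%:E)%E = r%:E.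
    exists (fine (\int[pair_law X Y]_z (expR (v * (f z - M)))%:E)%E).
    rewrite fineK// ge0_fin_numE ?(le_lt_trans h) ?ltry//.
    by apply: integral_ge0 => z _; rewrite lee_fin expR_ge0.
  have r0 : 0 <= r.
    rewrite -lee_fin -rE.
    by apply: integral_ge0 => z _; rewrite lee_fin expR_ge0.
  rewrite rE -EFin_expe lee_fin; move: h; rewrite rE lee_fin => h.
  apply: (@le_trans _ _ (expR (64 * v ^+ 2 * (K * expR K)) ^+ n)).
    rewrite lerXn2r ?nnegrE ?expR_ge0//.
    by rewrite (le_trans h)// expR_ge1Dx.
  rewrite -expRM_natl ler_expR.
  have -> : n%:R * (64 * v ^+ 2 * (K * expR K))
      = n%:R * v ^+ 2 * (64 * (K * expR K)) by ring.
  by rewrite nv2 mul1r.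
have mpair v : measurable_fun setT (fun w =>
    (expR (pair_sum X Y (fun z => v * (f z - M)) n w))%:E).
  apply/measurable_EFinP; apply: measurableT_comp => //.
  apply: measurable_pair_sum.
  by apply: measurable_funM => //; apply: measurable_funB.
have u12 : `|u| <= 2^-1 
  by rewrite /u normrV ?unitfE ?gt_eqF// (gtr0_norm s0) lef_pV2 ?posrE.
(* [expR `|x|] is at most [expR x + expR (- x)]; the second term is the first one
   for the scale [- u]. *)
apply: (@le_trans _ _ (\int[P]_w
  ((expR (pair_sum X Y (fun z => u * (f z - M)) n w))%:E
   + (expR (pair_sum X Y (fun z => - u * (f z - M)) n w))%:E))%E).
  apply: ge0_le_integral => //.
  - apply/measurable_EFinP; apply: measurableT_comp => //.
    by apply: measurableT_comp => //; exact: measurable_fluctuation.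
  - exact: emeasurable_funD.
  - move=> w _; rewrite fluctE -EFinD lee_fin.
    have -> : pair_sum X Y (fun z => - u * (f z - M)) n w
        = - pair_sum X Y (fun z => u * (f z - M)) n w.
      by rewrite /pair_sum -sumrN; apply: eq_bigr => i _; rewrite mulNr.
    set x := pair_sum _ _ _ _ _.
    have := expR_ge0 x; have := expR_ge0 (- x).
    by case: (ger0P x) => _ *; lra.
rewrite ge0_integralD//.
rewrite mulr_natl mulr2n EFinD; apply: leeD; first exact: one.
by apply: one; rewrite ?normrN ?sqrrN.
Qed.

End sample_mean_moment.

(** * Regularly varying tails *)

Section tail_variation.
Context {R : realType}.

(** Cauchy's form of the mean value theorem, for [ln \o L] against [ln]. *)
Lemma ln_comp_variation (L : R -> R) (e x y : R) : 0 < x -> x <= y ->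
  (forall z, x <= z -> z <= y ->
    [/\ 0 < L z, derivable L z 1 & `|z * derive1 L z / L z| <= e]) ->
  `|ln (L y) - ln (L x)| <= e * ln (y / x).
Proof.
move=> x0 xy HL; have y0 : 0 < y by exact: lt_le_trans xy.
move: xy; rewrite le_eqVlt => /predU1P[<-|xy].
  by rewrite subrr normr0 divff ?gt_eqF// ln1 mulr0.
(* The function [E * ln (L z) - D * ln z] takes the same value at [x] and [y]. *)
pose D := ln (L y) - ln (L x); pose E := ln y - ln x.
have E0 : 0 < E by rewrite subr_gt0 ltr_ln.
have dh z : x <= z -> z <= y ->
    is_derive z 1 (fun z => E * ln (L z) - D * ln z)
      (E * ((L z)^-1 * derive1 L z) - D * z^-1).
  move=> xz zy; have [Lz dL _] := HL z xz zy.
  have z0 : 0 < z by exact: lt_le_trans xz.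
  have dL' := derivableP dL; rewrite -derive1E in dL'.
  have dlnL := is_derive1_comp (is_derive1_ln Lz) dL'.
  have dln := is_derive1_ln z0.
  exact: (is_deriveB (is_deriveZ E dlnL) (is_deriveZ D dln)).
have [||c cxy] := @MVT R (fun z => E * ln (L z) - D * ln z)
  (fun z => E * ((L z)^-1 * derive1 L z) - D * z^-1) x y xy.
- by move=> z; rewrite in_itv/= => /andP[/ltW xz /ltW zy]; exact: dh xz zy.
- apply: derivable_within_continuous => z; rewrite in_itv/= => /andP[xz zy].
  by have [] := dh z xz zy.
move: cxy; rewrite in_itv/= => /andP[/ltW xc /ltW cy].
have [Lc _ ec] := HL c xc cy; have c0 : 0 < c by exact: lt_le_trans xc.
have -> : E * ln (L y) - D * ln y - (E * ln (L x) - D * ln x) = 0.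
  by rewrite /E /D; ring.
move/esym/eqP; rewrite mulf_eq0 [X in _ || X]subr_eq0 (gt_eqF xy) orbF subr_eq0 => /eqP h.
have {}h : D = E * (c * derive1 L c / L c).
  have -> : D = D / c * c by rewrite divfK// gt_eqF.
  by rewrite -h; ring.
rewrite -/D h normrM (gtr0_norm E0) ln_div ?posrE// -/E mulrC.
by rewrite ler_wpM2r// ltW.
Qed.

End tail_variation.

Section survival_function.
Context {R : realType} d (T : measurableType d) (P : probability T R).
Implicit Types (K : {RV P >-> R}) (F : R -> R).

Definition survival K (x : R) : R := fine (ccdf K x).

Lemma survivalE K x : (distribution P K `]x, +oo[ = (survival K x)%:E)%E.
Proof. by rewrite /survival fineK// fin_num_measure. Qed.

Lemma survival_le1 K x : survival K x <= 1.
Proof. by rewrite -lee_fin -survivalE probability_le1. Qed.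

Lemma survival_nonincreasing K x y : x <= y -> survival K y <= survival K x.
Proof. by move=> xy; rewrite -lee_fin -!survivalE ccdf_nonincreasing. Qed.

(** Beyond [t] the function decays like a power of exponent [alpha], up to an
error [e] in the exponent. *)
Definition power_decay F (alpha e t : R) := forall x y, t <= x -> x <= y ->
  [/\ 0 < F x, F x * expR (- (alpha + e) * ln (y / x)) <= F y
    & F y <= F x * expR (- (alpha - e) * ln (y / x))].

(** The logarithm of [survival K y / survival K x] is [- alpha * ln (y / x)] plus
the variation of [ln \o L], which the smoothness of [L] bounds by [ln (y / x)]
times the error at [x]; that error is at most the one at [t] since [ln] is
increasing. *)
Lemma power_decay_survival K (a alpha kappa : R) (L : R -> R) :
  0 < a -> 0 < kappa -> regularly_varying_tail K a alpha L ->
  log_smooth a kappa L ->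
  exists C x0, [/\ 0 <= C, 1 < x0 &
    forall t, x0 <= t -> power_decay (survival K) alpha (C / ln t `^ kappa) t].
Proof.
move=> a0 k0 [L0 _ LE] [dL [C0 [M [Mreal HM]]]].
pose C := Num.max C0 0; pose x0 := Num.max (a + 1) (Num.max (M + 1) 2).
have C_ge0 : 0 <= C by rewrite le_max lexx orbT.
have [ax0 Mx0 x02] : [/\ a < x0, M < x0 & 2 <= x0].
  by split; rewrite ?lt_max ?le_max ?ltrDl ?ltr01 ?lexx ?orbT.
have x01 : 1 < x0 by lra.
exists C, x0; split => // t t0 x y tx xy.
have x_gt0 : 0 < x by lra.
have y_gt0 : 0 < y by lra.
have lnt : 0 < ln t by rewrite ln_gt0//; lra.
have SE z : x <= z -> survival K z = expR (ln (L z) - alpha * ln z) /\ 0 < L z.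
  move=> xz; have az : a <= z by lra.
  rewrite /survival LE//= /powR gt_eqF; last by lra.
  split; last exact: L0.
  by rewrite expRD lnK ?posrE ?L0// mulNr.
have := @ln_comp_variation R L (C / ln t `^ kappa) x y x_gt0 xy.
move=> /(_ _)/wrap[].
  move=> z xz zy; split; [by apply: L0; lra | by apply: dL; lra |].
  apply: (le_trans (HM z _)); first by lra.
  have lntz : ln t <= ln z by rewrite ler_ln ?posrE; lra.
  apply: (@le_trans _ _ (C / ln z `^ kappa)).
    by rewrite ler_wpM2r ?invr_ge0 ?powR_ge0// le_max lexx.
  have lnz : 0 < ln z by exact: lt_le_trans lntz.
  rewrite ler_wpM2l// lef_pV2 ?posrE ?powR_gt0//.
  by apply: ge0_ler_powR; rewrite ?nnegrE ?(ltW k0) ?(ltW lnt) ?(ltW lnz).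
rewrite ln_div ?posrE// ler_norml => /andP[lo hi].
have [-> _] := SE x (lexx x); have [-> _] := SE y xy.
by split; rewrite ?expR_gt0// -expRD ler_expR; lra.
Qed.

(** There is no atom at [x]: by the lower bound on the decay, the values of the tail
slightly before [x] are arbitrarily close to its value at [x]. *)
Lemma survival_closed K (alpha e t x : R) : 0 < t -> 0 <= alpha + e ->
  power_decay (survival K) alpha e t -> t < x ->
  (distribution P K `[x, +oo[ = (survival K x)%:E)%E.
Proof.
move=> t0 ae H tx.
have fin : distribution P K `[x, +oo[ \is a fin_num by apply: fin_num_measure; exact: measurable_itv.
rewrite -(fineK fin); congr EFin; apply/eqP; rewrite eq_le; apply/andP; split; last first.
  rewrite -lee_fin -survivalE fineK//.
  by apply: le_measure; rewrite ?inE// => u /=; rewrite !in_itv/= !andbT => /ltW.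
set c := fine _.
have cle z : t <= z -> z < x -> c <= survival K x * expR ((alpha + e) * ln (x / z)).
  move=> tz zx; apply: (@le_trans _ _ (survival K z)).
    rewrite -lee_fin /c fineK// -survivalE.
    apply: le_measure; rewrite ?inE// => u /=.
    by rewrite !in_itv/= !andbT => /(lt_le_trans zx).
  have [_ h _] := H z x tz (ltW zx).
  by rewrite -ler_pdivrMr ?expR_gt0// -expRN -mulNr.
have x0 : 0 < x by exact: lt_trans tx.
have Sx0 : 0 < survival K x by have [] := H x x (ltW tx) (lexx x).
rewrite leNgt; apply/negP => cS.
pose q := ln (c / survival K x).
have q0 : 0 < q by rewrite ln_gt0// ltr_pdivlMr// mul1r.
have lnxt : 0 < ln (x / t) by rewrite ln_gt0// ltr_pdivlMr// mul1r.
(* A logarithmic step back from [x] that stays beyond [t], and too short for the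
   tail to reach the mass [c]. *)
pose u := Num.min (ln (x / t)) (q / (alpha + e + 1)).
have ae1 : 0 < alpha + e + 1 by lra.
have u0 : 0 < u by rewrite lt_min lnxt divr_gt0.
have := cle (x * expR (- u)).
rewrite invfM mulrA divff ?gt_eqF// mul1r expRN invrK expRK.
move=> /(_ _)/wrap[].
  rewrite ler_pdivlMr ?expR_gt0// mulrC -ler_pdivlMr//.
  rewrite -[leRHS]lnK ?posrE ?divr_gt0// ler_expR.
  by rewrite ge_min lexx.
have xux : x / expR u < x.
  by rewrite ltr_pdivrMr ?expR_gt0// ltr_pMr// -expR0 ltr_expR.
move=> /(_ xux).
rewrite -ler_pdivrMl// mulrC -[leLHS]lnK ?posrE ?divr_gt0//; last exact: lt_trans cS.
rewrite ler_expR -/q => h.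
have : u * (alpha + e + 1) <= q by rewrite -ler_pdivlMr// ge_min lexx orbT.
nra.
Qed.

End survival_function.

(** * The truncated logarithmic excess *)

(** Over [n] equal pieces of the interval the bounds telescope to a constant over
[n]. This replaces integration: it compares two functions whose increments agree
to first order, when the second-order error is a decrement of [F]. *)
Lemma le_of_increments {R : realType} (G F : R -> R) (c s : R) :
  0 <= s -> (forall u v, 0 <= u -> u <= v -> v <= s ->
    G v - G u <= c * (v - u) * (F u - F v)) -> G s <= G 0.
Proof.
move=> s0 H.
have step n : (0 < n)%N -> G s - G 0 <= c * s * (F 0 - F s) / n%:R.
  move=> n0; have nR : 0 < n%:R :> R by rewrite ltr0n.
  pose x k : R := s * (k%:R / n%:R).
  suff : forall k, (k <= n)%N -> G (x k) - G 0 <= c * (s / n%:R) * (F 0 - F (x k)).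
    move=> /(_ n (leqnn n)); rewrite /x divff ?gt_eqF// mulr1.
    by move=> /le_trans; apply; rewrite le_eqVlt; apply/orP; left; apply/eqP; ring.
  elim=> [_|k IH kn]; first by rewrite /x mul0r mulr0 !subrr mulr0.
  have := H (x k) (x k.+1).
  have xk0 : 0 <= x k by rewrite mulr_ge0// divr_ge0.
  have xkS : x k.+1 - x k = s / n%:R.
    by rewrite /x -addn1 natrD -mulrBr; field; rewrite gt_eqF.
  have xkk : x k <= x k.+1 by rewrite -subr_ge0 xkS divr_ge0.
  have xks : x k.+1 <= s.
    by rewrite /x -[leRHS]mulr1 ler_wpM2l// ler_pdivrMr// mul1r ler_nat.
  move=> /(_ xk0 xkk xks); rewrite xkS.
  have := IH (ltnW kn); rewrite !mulrBr; lra.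
rewrite leNgt; apply/negP => GG.
set D := c * s * (F 0 - F s) in step.
have d0 : 0 < G s - G 0 by rewrite subr_gt0.
have [n Hn] : exists n : nat, D / (G s - G 0) < n.+1%:R.
  exists (Num.bound (D / (G s - G 0))).
  have [q0|q0] := leP 0 (D / (G s - G 0)); last exact: lt_trans q0 _.
  by apply: (lt_trans (archi_boundP q0)); rewrite ltr_nat.
have := step n.+1 isT.
rewrite ler_pdivlMr ?ltr0n// leNgt => /negP; apply.
by rewrite mulrC -ltr_pdivrMr.
Qed.

Section truncated_excess.
Context {R : realType} d (T : measurableType d) (P : probability T R)
  (K : {RV P >-> R}) (alpha e t : R).
Hypotheses (t0 : 0 < t) (alpha0 : 0 < alpha) (e0 : 0 <= e) (ea : e <= alpha).
Let mu := distribution P K.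
Local Notation F := (survival K).
Hypothesis decay : power_decay F alpha e t.

(** The positive part of [ln (x / t)]. *)
Definition excess (x : R) : R := ln (Num.max x t / t).

Lemma excess_ge0 x : 0 <= excess x.
Proof. by rewrite ln_ge0// ler_pdivlMr// mul1r le_max lexx orbT. Qed.

Lemma measurable_excess : measurable_fun setT excess.
Proof.
apply: measurableT_comp; first exact: measurable_ln.
by apply: measurable_funM => //; exact: measurable_maxr.
Qed.

Lemma lt_excess x s : 0 <= s -> (s < excess x) = (t * expR s < x).
Proof.
move=> s0; have m0 : 0 < Num.max x t / t by rewrite divr_gt0// lt_max t0 orbT.
rewrite -[s < _]ltr_expR lnK ?posrE// ltr_pdivlMr// mulrC lt_max.
suff -> : (t * expR s < t) = false by rewrite orbF.
by rewrite -[ltRHS]mulr1 ltr_pM2l// -[1]expR0 ltr_expR ltNge s0.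
Qed.

Definition truncated_mean (s : R) : R := \int[mu]_x Num.min (excess x) s.

Let measurable_trunc s : measurable_fun setT (fun x => Num.min (excess x) s).
Proof. by apply: measurable_minr => //; exact: measurable_excess. Qed.

Lemma integrable_trunc s : 0 <= s ->
  mu.-integrable setT (fun x => (Num.min (excess x) s)%:E).
Proof.
move=> s0; apply: (@le_integrable _ _ _ _ _ _ _ (cst s%:E)) => //.
- exact/measurable_EFinP.
- move=> x _; rewrite lee_fin !ger0_norm// ?le_min ?excess_ge0//.
  by rewrite ge_min lexx orbT.
- exact: finite_measure_integrable_cst.
Qed.

(** Between levels [u] and [v] the truncated excess grows by [v - u] where the
excess is beyond [v], and by at most [v - u] where it is beyond [u]. *)
Lemma truncated_mean_increment (u v : R) : 0 <= u -> u <= v ->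
  (v - u) * F (t * expR v) <= truncated_mean v - truncated_mean u
    <= (v - u) * F (t * expR u).
Proof.
move=> u0 uv; have v0 : 0 <= v by exact: le_trans uv.
have mI w : measurable `]t * expR w, +oo[ by exact: measurable_itv.
have FE w : (v - u) * F (t * expR w)
    = \int[mu]_x ((v - u) * \1_`]t * expR w, +oo[ x).
  rewrite RintegralZl//; last exact: integrable_indic.
  by congr (_ * _); rewrite /Rintegral integral_indic// setIT.
have iI w : mu.-integrable setT (fun x => ((v - u) * \1_`]t * expR w, +oo[ x)%:E).
  by under eq_fun do rewrite EFinM; apply: integrableZl => //; exact: integrable_indic.
have iB : mu.-integrable setT
    (fun x => (Num.min (excess x) v - Num.min (excess x) u)%:E).
  under eq_fun do rewrite EFinB.
  by apply: integrableB => //; exact: integrable_trunc.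
rewrite -RintegralB//; [|exact: integrable_trunc|exact: integrable_trunc].
rewrite !FE; apply/andP; split;
  [apply: (le_Rintegral measurableT (iI v) iB)
  |apply: (le_Rintegral measurableT iB (iI u))] => x _;
  rewrite indicE mem_setE in_itv/= andbT -lt_excess//.
- have [vx|vx] := ltP v (excess x).
    by rewrite mulr1 (min_r (ltW (le_lt_trans uv vx))).
  by rewrite mulr0 subr_ge0 ge_min lexx.
- have [ux|ux] := ltP u (excess x).
    by rewrite mulr1 lerD2r ge_min lexx orbT.
  by rewrite mulr0 (min_l (le_trans ux uv)) subrr.
Qed.

Let decrement (u v : R) : 0 <= u -> u <= v ->
  (alpha - e) * (v - u) * F (t * expR v) <= F (t * expR u) - F (t * expR v)
    <= (alpha + e) * (v - u) * F (t * expR u).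
Proof.
move=> u0 uv.
have tu : t <= t * expR u by rewrite -[leLHS]mulr1 ler_pM2l// -[1]expR0 ler_expR.
have uv' : t * expR u <= t * expR v by rewrite ler_pM2l// ler_expR.
have [Fu lo hi] := decay tu uv'.
have [Fv _ _] := decay (le_trans tu uv') (lexx _).
have E : ln (t * expR v / (t * expR u)) = v - u.
  by rewrite -mulf_div divff ?gt_eqF// mul1r -expRN -expRD expRK.
rewrite E in lo hi; apply/andP; split.
  have : F (t * expR v) * expR ((alpha - e) * (v - u)) <= F (t * expR u).
    by rewrite -ler_pdivlMr ?expR_gt0// -expRN -mulNr.
  have := expR_ge1Dx ((alpha - e) * (v - u)); nra.
have := expR_ge1Dx (- (alpha + e) * (v - u)); nra.
Qed.

Lemma truncated_mean0 : truncated_mean 0 = 0.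
Proof.
transitivity (\int[mu]_x (0 : R)); last by rewrite Rintegral_cst// mul0r.
by apply: eq_Rintegral => x _; rewrite min_r// excess_ge0.
Qed.

(** Both sides have the same increments up to the relative error [e]. For [e = 0]
this is the identity [alpha * E(min(N, s)) = Prob(N <= s)] satisfied by an
exponential variable [N] of rate [alpha]. *)
Lemma truncated_mean_bias (s : R) : 0 <= s ->
  (alpha - e) * truncated_mean s <= F t - F (t * expR s)
    <= (alpha + e) * truncated_mean s.
Proof.
move=> s0.
have F0 : F (t * expR 0) = F t by rewrite expR0 mulr1.
have ae0 : 0 <= alpha - e by rewrite subr_ge0.
pose Fe u := F (t * expR u).
apply/andP; split.
- have := @le_of_increments _ (fun u => (alpha - e) * truncated_mean u + Fe u) Fe
    (alpha - e) s s0.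
  move=> /(_ _)/wrap[].
    move=> u v u0 uv vs.
    have /andP[_ hi] := truncated_mean_increment u0 uv.
    have /andP[lo _] := decrement u0 uv.
    by rewrite /Fe; nra.
  by rewrite truncated_mean0 mulr0 add0r /Fe F0; lra.
- have := @le_of_increments _ (fun u => - (alpha + e) * truncated_mean u - Fe u) Fe
    (alpha + e) s s0.
  move=> /(_ _)/wrap[].
    move=> u v u0 uv vs.
    have /andP[lo _] := truncated_mean_increment u0 uv.
    have /andP[_ hi] := decrement u0 uv.
    have ae : 0 <= alpha + e by rewrite addr_ge0// ltW.
    by rewrite /Fe; nra.
  by rewrite truncated_mean0 mulr0 sub0r /Fe F0; lra.
Qed.

End truncated_excess.

Section excess_moment.
Context {R : realType} d (T : measurableType d) (P : probability T R)
  (K : {RV P >-> R}) (alpha e t : R).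
Hypotheses (t0 : 0 < t) (alpha0 : 0 < alpha) (ea : e <= alpha / 2).
Let mu := distribution P K.
Local Notation F := (survival K).
Hypothesis decay : power_decay F alpha e t.
Local Notation excess := (excess t).
Let lam := alpha / 4.

Let truncated_exp (s : R) : R := \int[mu]_x expR (lam * Num.min (excess x) s).

Let lam0 : 0 < lam. Proof. by rewrite divr_gt0. Qed.

Let mexp s : measurable_fun setT (fun x => expR (lam * Num.min (excess x) s)).
Proof.
apply: measurableT_comp => //; apply: measurable_funM => //.
by apply: measurable_minr => //; exact: measurable_excess.
Qed.

Let integrable_truncated s : 0 <= s ->
  mu.-integrable setT (fun x => (expR (lam * Num.min (excess x) s))%:E).
Proof.
move=> s0; apply: (@le_integrable _ _ _ _ _ _ _ (cst (expR (lam * s))%:E)) => //.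
- exact/measurable_EFinP.
- move=> x _; rewrite lee_fin !ger0_norm ?expR_ge0// ler_expR ler_pM2l//.
  by rewrite ge_min lexx orbT.
- exact: finite_measure_integrable_cst.
Qed.

Let increment (u v : R) : 0 <= u -> u <= v ->
  truncated_exp v - truncated_exp u
    <= (expR (lam * v) - expR (lam * u)) * expR (- (2 * lam) * u).
Proof.
move=> u0 uv; have v0 : 0 <= v by exact: le_trans uv.
set c := expR _ - _.
have c0 : 0 <= c by rewrite subr_ge0 ler_expR ler_pM2l.
have tail_le : F (t * expR u) <= expR (- (2 * lam) * u).
  have tu : t <= t * expR u by rewrite -[leLHS]mulr1 ler_pM2l// -[1]expR0 ler_expR.
  have [_ _ hi] := decay (lexx t) tu.
  rewrite mulrAC divff ?gt_eqF// mul1r expRK in hi.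
  apply: (le_trans hi).
  have := survival_le1 K t; have [Ft _ _] := decay (lexx t) (lexx t).
  have h : expR (- (alpha - e) * u) <= expR (- (2 * lam) * u).
    by rewrite ler_expR ler_wpM2r// lerN2 /lam; move: ea; lra.
  have := expR_ge0 (- (alpha - e) * u); nra.
apply: (@le_trans _ _ (c * F (t * expR u))); last by rewrite ler_wpM2l.
have iI : mu.-integrable setT (fun x => (c * \1_`]t * expR u, +oo[ x)%:E).
  by under eq_fun do rewrite EFinM; apply: integrableZl => //; exact: integrable_indic.
have -> : c * F (t * expR u) = \int[mu]_x (c * \1_`]t * expR u, +oo[ x).
  rewrite RintegralZl//; last exact: integrable_indic.
  by congr (_ * _); rewrite /Rintegral integral_indic// setIT.
have iB : mu.-integrable setT (fun x => (expR (lam * Num.min (excess x) v)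
    - expR (lam * Num.min (excess x) u))%:E).
  under eq_fun do rewrite EFinB.
  by apply: integrableB => //; exact: integrable_truncated.
rewrite -RintegralB//; [|exact: integrable_truncated|exact: integrable_truncated].
apply: (le_Rintegral measurableT iB iI) => x _.
rewrite indicE mem_setE in_itv/= andbT -lt_excess//.
have [ux|ux] := ltP u (excess x).
  by rewrite mulr1 lerD2r ler_expR ler_pM2l// ge_min lexx orbT.
by rewrite mulr0 (min_l (le_trans ux uv)) subrr.
Qed.

(** The increments of [expR (- lam * u)] cancel those of [truncated_exp] to first
order, so that their sum does not exceed its value 2 at the origin. *)
Let truncated_exp_le (s : R) : 0 <= s -> truncated_exp s <= 2.
Proof.
move=> s0.
have := @le_of_increments _ (fun u => truncated_exp u + expR (- lam * u))
  (fun u => expR (- (2 * lam) * u)) (lam * expR (lam * s)) s s0.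
move=> /(_ _)/wrap[].
  move=> u v u0 uv vs; have inc := increment u0 uv.
  have e1 : expR (lam * v) - expR (lam * u) <= lam * (v - u) * expR (lam * v).
    have -> : lam * u = lam * v + - (lam * (v - u)) by ring.
    rewrite expRD; have := expR_ge1Dx (- (lam * (v - u))).
    have := expR_gt0 (lam * v); nra.
  have e2 : expR (- lam * v) - expR (- lam * u) <= - (lam * (v - u)) * expR (- lam * v).
    have -> : - lam * u = - lam * v + lam * (v - u) by ring.
    rewrite expRD; have := expR_ge1Dx (lam * (v - u)).
    have := expR_gt0 (- lam * v); nra.
  have e3 : expR (lam * v) <= expR (lam * s) by rewrite ler_expR ler_pM2l.
  have e4 : expR (- lam * v) = expR (lam * v) * expR (- (2 * lam) * v).
    by rewrite -expRD; congr expR; ring.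
  have e5 : expR (- (2 * lam) * v) <= expR (- (2 * lam) * u).
    by rewrite ler_expR !mulNr lerN2 ler_pM2l// mulr_gt0.
  have luv : 0 <= lam * (v - u) by rewrite mulr_ge0 ?subr_ge0 ?(ltW lam0).
  have u2 := expR_gt0 (- (2 * lam) * u).
  rewrite e4 in e2.
  have h1 : truncated_exp v - truncated_exp u <=
      lam * (v - u) * expR (lam * v) * expR (- (2 * lam) * u).
    by apply: (le_trans inc); rewrite ler_wpM2r// ltW.
  have h2 : lam * (v - u) * (expR (- (2 * lam) * u) - expR (- (2 * lam) * v)) * expR (lam * v)
     <= lam * (v - u) * (expR (- (2 * lam) * u) - expR (- (2 * lam) * v)) * expR (lam * s).
    by rewrite ler_wpM2l// mulr_ge0// subr_ge0.
  rewrite e4; lra.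
have -> : truncated_exp 0 = 1.
  transitivity (\int[mu]_x (1 : R)).
    by apply: eq_Rintegral => x _; rewrite min_r ?excess_ge0// mulr0 expR0.
  by rewrite Rintegral_cst// mul1r; have := probability_setT mu => /= ->.
rewrite mulr0 expR0; have := expR_gt0 (- lam * s); lra.
Qed.

(** The excess is stochastically dominated by an exponential variable of rate
[alpha / 2], whose exponential moment of order [alpha / 4] is 2. *)
Lemma exp_moment_excess :
  (\int[distribution P K]_x (expR (alpha / 4 * excess x))%:E <= 2%:E)%E.
Proof.
have cvgx x : (expR (lam * Num.min (excess x) n%:R))%:E @[n --> \oo]
    --> (expR (lam * excess x))%:E.
  apply: cvg_near_cst; near=> n; rewrite min_l//.
  by near: n; exact: nbhs_infty_ger.
rewrite -/mu -/lam.
under eq_integral do rewrite -(cvg_lim _ (cvgx _))//.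
rewrite monotone_convergence//.
- apply: lime_le.
    apply: ereal_nondecreasing_is_cvgn => m n mn.
    apply: ge0_le_integral => //; do ?exact/measurable_EFinP.
    move=> x _; rewrite lee_fin ler_expR ler_pM2l// le_min !ge_min lexx/=.
    by rewrite ler_nat mn orbT.
  apply: nearW => n; have := @truncated_exp_le n%:R (ler0n _ _).
  rewrite -lee_fin /truncated_exp /Rintegral fineK//.
  exact: integrable_fin_num (integrable_truncated _).
- by move=> n; exact/measurable_EFinP.
- move=> x _ m n mn; rewrite lee_fin ler_expR ler_pM2l// le_min !ge_min lexx/=.
  by rewrite ler_nat mn orbT.
Unshelve. all: by end_near. Qed.

End excess_moment.

(** * The score of a censored observation *)

Section score.
Context {R : realType}.
Implicit Types (t : R) (z : R * R).

(** The pair [z] consists of a datum and its censoring time. The sample means of the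
next two functions are [phat] and [qhat]. *)
Definition atrisk t z : R := (t <= Num.min z.1 z.2)%R%:R.

Definition failure t z : R := (z.1 <= z.2)%R%:R * (t <= Num.min z.1 z.2)%R%:R.

Definition logexcess t z : R :=
  ln (Num.min z.1 z.2 / t) * (t <= Num.min z.1 z.2)%R%:R.

(** For a datum with an exact power tail of exponent [alpha], this is the
compensator of the failure indicator minus the indicator itself, and its
expectation is zero. *)
Definition score alpha t z : R := alpha * logexcess t z - failure t z.

Let mmin : measurable_fun setT (fun z : R * R => Num.min z.1 z.2).
Proof. exact: measurable_minr. Qed.

Lemma measurable_atrisk t : measurable_fun setT (atrisk t).
Proof.
have -> : atrisk t = (\1_`[t, +oo[ : R -> R) \o (fun z : R * R => Num.min z.1 z.2).
  by apply/funext => z /=; rewrite indicE mem_setE in_itv/= andbT.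
exact: measurableT_comp.
Qed.

Lemma measurable_failure t : measurable_fun setT (failure t).
Proof.
apply: measurable_funM; last exact: measurable_atrisk.
have -> : (fun z : R * R => (z.1 <= z.2)%R%:R) =
    (\1_`[0, +oo[ : R -> R) \o (fun z : R * R => z.2 - z.1).
  by apply/funext => z /=; rewrite indicE mem_setE in_itv/= andbT subr_ge0.
by apply: measurableT_comp => //; exact: measurable_funB.
Qed.

Lemma measurable_logexcess t : measurable_fun setT (logexcess t).
Proof.
apply: measurable_funM; last exact: measurable_atrisk.
apply: measurableT_comp; first exact: measurable_ln.
exact: measurable_funM.
Qed.

Lemma measurable_score alpha t : measurable_fun setT (score alpha t).
Proof.
apply: measurable_funB; last exact: measurable_failure.
by apply: measurable_funM => //; exact: measurable_logexcess.
Qed.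

Lemma atrisk_ge0 t z : 0 <= atrisk t z. Proof. exact: ler0n. Qed.

Lemma atrisk_le1 t z : atrisk t z <= 1.
Proof. by rewrite /atrisk; case: (t <= _). Qed.

Lemma failure_ge0 t z : 0 <= failure t z. Proof. by apply: mulr_ge0; exact: ler0n. Qed.

Lemma failure_le1 t z : failure t z <= 1.
Proof. by rewrite /failure; case: (z.1 <= z.2); case: (t <= _); rewrite ?mulr0 ?mulr1 ?mul0r. Qed.

Lemma logexcess_ge0 t z : 0 < t -> 0 <= logexcess t z.
Proof.
move=> t0; rewrite /logexcess; have [h|h] := leP t (Num.min z.1 z.2); rewrite ?mulr0// mulr1.
by rewrite ln_ge0// ler_pdivlMr// mul1r.
Qed.

Lemma logexcess_le t z : 0 < t -> logexcess t z <= excess t z.1.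
Proof.
move=> t0; rewrite /logexcess; have [h|h] := leP t (Num.min z.1 z.2); last by rewrite mulr0 excess_ge0.
rewrite mulr1 ler_ln ?posrE ?divr_gt0 ?(lt_le_trans t0) ?le_max ?lexx ?orbT//.
by rewrite ler_pM2r ?invr_gt0// le_max ge_min lexx.
Qed.

Lemma logexcessE t x y : 0 < t -> t <= y ->
  logexcess t (x, y) = Num.min (excess t x) (ln (y / t)).
Proof.
move=> t0 ty; rewrite /logexcess /excess /=.
have y0 : 0 < y by exact: lt_le_trans ty.
have [tx|xt] := leP t x.
  rewrite le_min tx ty mulr1.
  have x0 : 0 < x by exact: lt_le_trans tx.
  have [xy|yx] := leP x y; first by rewrite min_l// ler_ln ?posrE ?divr_gt0// ler_pM2r ?invr_gt0.
  by rewrite min_r// ler_ln ?posrE ?divr_gt0// ler_pM2r ?invr_gt0// ltW.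
rewrite le_min leNgt xt /= mulr0 divff ?gt_eqF// ln1 min_l//.
by rewrite ln_ge0// ler_pdivlMr// mul1r.
Qed.

Lemma logexcess_below t x y : y < t -> logexcess t (x, y) = 0.
Proof. by move=> yt; rewrite /logexcess/= le_min [t <= y]leNgt yt andbF mulr0. Qed.

Lemma failure_below t x y : y < t -> failure t (x, y) = 0.
Proof. by move=> yt; rewrite /failure/= le_min [t <= y]leNgt yt andbF mulr0. Qed.

Lemma failureE t x y : t <= y -> failure t (x, y) = \1_`[t, y] x.
Proof.
move=> ty; rewrite /failure/= indicE mem_setE in_itv/= le_min ty andbT -natrM mulnb.
by rewrite andbC.
Qed.

End score.

Section score_law.
Context {R : realType} d (T : measurableType d) (P : probability T R)
  (K1 K2 : {RV P >-> R}) (alpha e t : R).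
Hypotheses (t0 : 0 < t) (alpha0 : 0 < alpha) (e0 : 0 <= e) (ea : e <= alpha / 2).
Hypotheses (decay1 : power_decay (survival K1) alpha e t)
  (closed1 : forall x, t <= x -> (distribution P K1 `[x, +oo[ = (survival K1 x)%:E)%E)
  (closed2 : (distribution P K2 `[t, +oo[ = (survival K2 t)%:E)%E).
Let m1 := distribution P K1.
Let m2 := distribution P K2.
Let law : probability (R * R)%type R := (m1 \x m2)%E.
Local Notation F := (survival K1).
Local Notation G := (survival K2).

Let section_failure y : t <= y ->
  (\int[m1]_x (failure t (x, y))%:E = (F t - F y)%:E)%E.
Proof.
move=> ty; under eq_integral do rewrite failureE//.
rewrite integral_indic// setIT.
have -> : `[t, y]%classic = `[t, +oo[ `\` `]y, +oo[ :> set R.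
  apply/seteqP; split => x /=; rewrite !in_itv/= !andbT.
    by move=> /andP[-> xy]; split => //; apply/negP; rewrite -leNgt.
  by move=> [-> /negP]; rewrite -leNgt => ->.
rewrite measureD//; last by apply: (le_lt_trans (probability_le1 m1 _)) => //; exact: ltry.
rewrite (_ : _ `&` _ = `]y, +oo[%classic); last first.
  apply/seteqP; split => x /=; rewrite !in_itv/= !andbT; first by case.
  by move=> yx; split => //; apply: ltW; exact: le_lt_trans yx.
by rewrite [X in (X - _)%E]closed1// [X in (_ - X)%E]survivalE EFinB.
Qed.

Let section_logexcess y : t <= y ->
  (\int[m1]_x (logexcess t (x, y))%:E
   = (truncated_mean K1 t (ln (y / t)))%:E)%E.
Proof.
move=> ty; under eq_integral do rewrite logexcessE//.
have s0 : 0 <= ln (y / t) by rewrite ln_ge0// ler_pdivlMr// mul1r.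
rewrite /truncated_mean /Rintegral fineK//.
exact: integrable_fin_num (integrable_trunc _ t0 s0).
Qed.

(** The expected failure probability and the expected log-excess of a censored
observation, given its censoring time, agree up to the relative error of the
tail. *)
Let section_bias y :
  ((1 - 2 * e / alpha)%:E * \int[m1]_x (failure t (x, y))%:E
    <= \int[m1]_x (alpha * logexcess t (x, y))%:E
    <= (1 + 2 * e / alpha)%:E * \int[m1]_x (failure t (x, y))%:E)%E.
Proof.
have [ty|yt] := leP t y; last first.
  have -> : (\int[m1]_x (failure t (x, y))%:E = 0)%E.
    by apply: integral0_eq => x _; rewrite failure_below.
  have -> : (\int[m1]_x (alpha * logexcess t (x, y))%:E = 0)%E.
    by apply: integral0_eq => x _; rewrite logexcess_below// mulr0.
  by rewrite !mule0 lexx.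
have s0 : 0 <= ln (y / t) by rewrite ln_ge0// ler_pdivlMr// mul1r.
have mle : measurable_fun setT (fun x => (logexcess t (x, y))%:E).
  apply/measurable_EFinP; apply: (measurableT_comp (measurable_logexcess t)).
  exact: measurable_fun_pair.
have -> : (\int[m1]_x (alpha * logexcess t (x, y))%:E
    = alpha%:E * \int[m1]_x (logexcess t (x, y))%:E)%E.
  rewrite -ge0_integralZl//; last by rewrite lee_fin ltW.
  by move=> x _; rewrite lee_fin logexcess_ge0.
rewrite section_logexcess// section_failure// -!EFinM !lee_fin.
have ea' : e <= alpha by move: ea alpha0; lra.
have := truncated_mean_bias t0 alpha0 e0 ea' decay1 s0.
have y0 : 0 < y by exact: lt_le_trans ty.
rewrite lnK ?posrE ?divr_gt0// mulrCA mulfV ?gt_eqF// mulr1.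
set D := F t - F y; set J := truncated_mean _ _ _ => /andP[lo hi].
have D0 : 0 <= D by rewrite subr_ge0 survival_nonincreasing.
pose q := e / alpha.
have q0 : 0 <= q by rewrite divr_ge0// ltW.
have q2 : q <= 2^-1 by rewrite ler_pdivrMr// mulrC.
have eq : e = q * alpha by rewrite /q divfK// gt_eqF.
have -> : 2 * e / alpha = 2 * q by rewrite /q mulrA.
rewrite eq in lo hi; set A := alpha * J.
have {}lo : (1 - q) * A <= D by move: lo; rewrite /A; lra.
have {}hi : D <= (1 + q) * A by move: hi; rewrite /A; lra.
apply/andP; split; nra.
Qed.

Let fubini_failure : (\int[law]_z (failure t z)%:E
  = \int[m2]_y \int[m1]_x (failure t (x, y))%:E)%E.
Proof.
rewrite fubini_tonelli2//; first by apply/measurable_EFinP; exact: measurable_failure.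
by move=> z; rewrite lee_fin failure_ge0.
Qed.

Let fubini_logexcess : (\int[law]_z (alpha * logexcess t z)%:E
  = \int[m2]_y \int[m1]_x (alpha * logexcess t (x, y))%:E)%E.
Proof.
rewrite fubini_tonelli2//.
  by apply/measurable_EFinP; apply: measurable_funM => //; exact: measurable_logexcess.
by move=> z; rewrite lee_fin mulr_ge0 ?logexcess_ge0// ltW.
Qed.

Lemma integrable_failure : law.-integrable setT (fun z => (failure t z)%:E).
Proof.
apply: (@le_integrable _ _ _ _ _ _ _ (cst 1%E)) => //.
- by apply/measurable_EFinP; exact: measurable_failure.
- by move=> z _; rewrite lee_fin normr1 ger0_norm ?failure_ge0 ?failure_le1.
- exact: finite_measure_integrable_cst.
Qed.

Let ratio_le1 : 2 * e / alpha <= 1.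
Proof. by rewrite ler_pdivrMr// mul1r; move: ea; lra. Qed.

Let measurable_section (f : R * R -> R) : measurable_fun setT f ->
  (forall z, 0 <= f z) ->
  measurable_fun setT (fun y => \int[m1]_x (f (x, y))%:E)%E.
Proof.
move=> mf f0.
apply: (@measurable_fun_fubini_tonelli_G _ _ _ _ _ m1 (EFin \o f)).
  exact/measurable_EFinP.
by move=> z; rewrite lee_fin.
Qed.

Let mean_bias :
  ((1 - 2 * e / alpha)%:E * \int[law]_z (failure t z)%:E
    <= \int[law]_z (alpha * logexcess t z)%:E
    <= (1 + 2 * e / alpha)%:E * \int[law]_z (failure t z)%:E)%E.
Proof.
have c0 : 0 <= 2 * e / alpha by rewrite divr_ge0 ?mulr_ge0// ltW.
have mF := measurable_section (measurable_failure t) (failure_ge0 t).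
have F0 y : (0 <= \int[m1]_x (failure t (x, y))%:E)%E.
  by apply: integral_ge0 => x _; rewrite lee_fin failure_ge0.
have aL0 z : 0 <= alpha * logexcess t z by rewrite mulr_ge0 ?logexcess_ge0// ltW.
have mL : measurable_fun setT (fun z => alpha * logexcess t z).
  by apply: measurable_funM => //; exact: measurable_logexcess.
have mL' := measurable_section mL aL0.
have L0 y : (0 <= \int[m1]_x (alpha * logexcess t (x, y))%:E)%E.
  by apply: integral_ge0 => x _; rewrite lee_fin.
have cl : 0 <= 1 - 2 * e / alpha by rewrite subr_ge0.
have cr : 0 <= 1 + 2 * e / alpha by rewrite addr_ge0.
rewrite fubini_failure fubini_logexcess -!ge0_integralZl//.
apply/andP; split; apply: ge0_le_integral => //.
- by move=> y _; rewrite mule_ge0.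
- exact: measurable_funeM.
- by move=> y _; have /andP[] := section_bias y.
- exact: measurable_funeM.
- by move=> y _; have /andP[] := section_bias y.
Qed.

Let failure_num : (\int[law]_z (failure t z)%:E = (\int[law]_z failure t z)%:E)%E.
Proof.
by rewrite /Rintegral fineK//; exact: integrable_fin_num integrable_failure.
Qed.

Let integrable_logexcess :
  law.-integrable setT (fun z => (alpha * logexcess t z)%:E).
Proof.
apply/integrableP; split.
  by apply/measurable_EFinP; apply: measurable_funM => //; exact: measurable_logexcess.
rewrite (eq_integral (fun z => (alpha * logexcess t z)%:E)); last first.
  move=> z _; rewrite gee0_abs// lee_fin.
  by apply: mulr_ge0; [exact: ltW|exact: logexcess_ge0].
have /andP[_ hi] := mean_bias; apply: (le_lt_trans hi).
by rewrite failure_num -EFinM ltry.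
Qed.

(** Averaging [section_bias] over the censoring time. *)
Lemma score_bias : `|\int[law]_z score alpha t z|
  <= 2 * e / alpha * \int[law]_z failure t z.
Proof.
have -> : \int[law]_z score alpha t z =
    \int[law]_z (alpha * logexcess t z) - \int[law]_z failure t z.
  by rewrite -RintegralB//; exact: integrable_failure.
have := mean_bias.
have -> : (\int[law]_z (alpha * logexcess t z)%:E
    = (\int[law]_z (alpha * logexcess t z))%:E)%E.
  by rewrite /Rintegral fineK//; exact: integrable_fin_num integrable_logexcess.
rewrite failure_num -!EFinM !lee_fin => /andP[lo hi].
by rewrite ler_norml; apply/andP; split; lra.
Qed.

(** Counts the failures between [t] and [2 * t] among the data whose censoring time
exceeds [2 * t]. *)
Lemma mean_failure_ge :
  (1 - expR (- (alpha / 2) * ln 2)) * F t * G (2 * t)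
    <= \int[law]_z failure t z.
Proof.
rewrite -lee_fin -failure_num fubini_failure.
set c := (1 - _) * _.
have t2t : t <= 2 * t by rewrite ler_peMl ?ler1n// ltW.
have F0 : 0 < F t by have [] := decay1 (lexx t) (lexx t).
have ln2 : 0 <= ln 2 :> R by rewrite ln_ge0// ler1n.
have c0 : 0 <= c.
  rewrite mulr_ge0 ?(ltW F0)// subr_ge0 -[leRHS]expR0 ler_expR mulNr oppr_le0.
  by rewrite mulr_ge0// ltW// divr_gt0.
have cF y : 2 * t <= y -> c <= F t - F y.
  move=> ty; have := survival_nonincreasing K1 ty.
  have [_ _] := decay1 (lexx t) t2t.
  rewrite mulfK ?gt_eqF// => hi.
  have : expR (- (alpha - e) * ln 2) <= expR (- (alpha / 2) * ln 2).
    by rewrite ler_expR ler_wpM2r// lerN2; move: ea; lra.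
  by rewrite /c; nra.
have -> : ((c * G (2 * t))%:E = \int[m2]_y (c * \1_`]2 * t, +oo[ y)%:E)%E.
  under eq_integral do rewrite EFinM.
  rewrite ge0_integralZl//.
  - by rewrite integral_indic// setIT EFinM; congr (_ * _)%E; rewrite -survivalE.
  - exact/measurable_EFinP.
apply: ge0_le_integral => //.
- by move=> y _; rewrite lee_fin mulr_ge0.
- by apply/measurable_EFinP; apply: measurable_funM.
- exact: measurable_section (measurable_failure t) (failure_ge0 t).
- move=> y _; rewrite indicE mem_setE in_itv/= andbT.
  have [ty|yt] := ltP (2 * t) y; last first.
    rewrite mulr0; apply: integral_ge0 => x _.
    by rewrite lee_fin failure_ge0.
  rewrite mulr1 section_failure ?lee_fin ?cF ?(ltW ty)//.
  exact: le_trans (ltW ty).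
Qed.

Lemma mean_atrisk : \int[law]_z atrisk t z = F t * G t.
Proof.
have E z : (atrisk t z)%:E = (\1_(`[t, +oo[ `*` `[t, +oo[) z)%:E :> \bar R.
  case: z => x y; rewrite /atrisk indicE/=; congr ((_ _)%:R%:E).
  apply/idP/idP; rewrite le_min inE/= !in_itv/= !andbT.
    by move=> /andP[].
  by move=> [-> ->].
rewrite /Rintegral; under eq_integral do rewrite E.
rewrite integral_indic//; last exact: measurableX.
rewrite setIT.
transitivity (fine ((m1 \x m2)%E (`[t, +oo[ `*` `[t, +oo[))) => //.
rewrite product_measure1E//.
by rewrite [X in (X * _)%E]closed1// [X in (_ * X)%E]closed2.
Qed.

(** The failure indicator is bounded and the log-excess is at most the uncensored
excess; the factor 4 brings the score within reach of [exp_moment_excess]. *)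
Lemma exp_moment_score :
  (\int[law]_z (expR `|score alpha t z / 4|)%:E <= (2 * expR 1)%:E)%E.
Proof.
have mexc : measurable_fun setT (fun x => (expR (alpha / 4 * excess t x))%:E).
  apply/measurable_EFinP; apply: measurableT_comp => //.
  by apply: measurable_funM => //; exact: measurable_excess.
have bound z : expR `|score alpha t z / 4|
    <= expR 1 * expR (alpha / 4 * excess t z.1).
  rewrite -expRD ler_expR /score.
  have := failure_ge0 t z; have := failure_le1 t z.
  have := logexcess_ge0 z t0; have := logexcess_le z t0.
  set L := logexcess _ _; set f := failure _ _; set N := excess _ _ => LN L0 f1 f0.
  have aL : 0 <= alpha * L by rewrite mulr_ge0// ltW.
  have aLN : alpha * L <= alpha * N by rewrite ler_wpM2l// ltW.
  by rewrite ler_norml; apply/andP; split; lra.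
apply: (@le_trans _ _
    (\int[law]_z (expR 1 * expR (alpha / 4 * excess t z.1))%:E)%E).
  apply: ge0_le_integral => //.
  - apply/measurable_EFinP; apply: measurableT_comp => //.
    apply: measurableT_comp => //; apply: measurable_funM => //.
    exact: measurable_score.
  - apply/measurable_EFinP; apply: measurable_funM => //.
    apply: measurableT_comp => //; apply: measurable_funM => //.
    by apply: (measurableT_comp (measurable_excess t)).
  - by move=> z _; rewrite lee_fin.
rewrite fubini_tonelli1//=; last first.
  apply/measurable_EFinP; apply: measurable_funM => //.
  apply: measurableT_comp => //; apply: measurable_funM => //.
  by apply: (measurableT_comp (measurable_excess t)).
rewrite /fubini_F /=.
have -> : (\int[m1]_x \int[m2]_y (expR 1 * expR (alpha / 4 * excess t x))%:E
    = \int[m1]_x ((expR 1)%:E * (expR (alpha / 4 * excess t x))%:E))%E.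
  apply: eq_integral => x _; rewrite integral_cst// -EFinM -[RHS]mule1.
  by congr (_ * _)%E; exact: probability_setT.
rewrite ge0_integralZl//.
rewrite (mulrC 2) EFinM; apply: lee_wpmul2l; first by rewrite lee_fin expR_ge0.
exact: (exp_moment_excess t0 alpha0 ea decay1).
Qed.

End score_law.

(** * The population quantities at a high threshold *)

Section population.
Context {R : realType} d (T : measurableType d) (P : probability T R)
  (X Y : nat -> {RV P >-> R}) (a alphaX alphaY kappa b : R) (LX LY : R -> R).
Hypotheses (a_gt0 : 0 < a) (alphaX_gt0 : 0 < alphaX) (alphaY_gt0 : 0 < alphaY)
  (X_tail : regularly_varying_tail (X 0%N) a alphaX LX)
  (Y_tail : regularly_varying_tail (Y 0%N) a alphaY LY)
  (kappa_gt0 : 0 < kappa)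
  (LX_smooth : log_smooth a kappa LX) (LY_smooth : log_smooth a kappa LY)
  (b_gt : alphaX + alphaY < b).
Local Notation law := (pair_law X Y).

Lemma log_power_small (C eta : R) : 0 <= C -> 0 < eta ->
  exists2 x0, 1 < x0 & forall t, x0 <= t -> C / ln t `^ kappa <= eta.
Proof.
move=> C0 eta0; pose M := (C / eta + 1) `^ kappa^-1.
have Ce : 0 < C / eta + 1 by rewrite ltr_wpDl// divr_ge0// ltW.
have M0 : 0 < M by exact: powR_gt0.
exists (expR M); first by rewrite -[ltLHS]expR0 ltr_expR.
move=> t Mt; have t0 : 0 < t by exact: lt_le_trans (expR_gt0 _) Mt.
have lnt : M <= ln t by rewrite -[M]expRK ler_ln ?posrE ?expR_gt0.
have : M `^ kappa <= ln t `^ kappa.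
  by apply: ge0_ler_powR; rewrite ?nnegrE ?(ltW kappa_gt0) ?(ltW M0) ?(le_trans (ltW M0)).
rewrite /M -powRrM mulVf ?gt_eqF// powRr1 ?(ltW Ce)// => h.
rewrite ler_pdivrMr; last exact: lt_le_trans h.
have : C / eta <= ln t `^ kappa by apply: le_trans h; rewrite lerDl.
by rewrite ler_pdivrMr// mulrC.
Qed.

(** The margin [b - alphaX - alphaY] absorbs the errors in the two exponents, once
the threshold is high enough for each to be below half of it. *)
Lemma population_regime : exists C c0 c1 x0,
  [/\ 0 <= C, 0 < c0, 0 < c1, 1 < x0 & forall t, x0 <= t ->
    [/\ `|\int[law]_z score alphaX t z|
          <= C / ln t `^ kappa * \int[law]_z failure t z,
        c0 * \int[law]_z atrisk t z <= \int[law]_z failure t z,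
        c1 * t `^ (- b) <= \int[law]_z atrisk t z &
        (\int[law]_z (expR `|score alphaX t z / 4|)%:E <= (2 * expR 1)%:E)%E]].
Proof.
pose eta := (b - alphaX - alphaY) / 2.
have eta0 : 0 < eta by rewrite /eta divr_gt0//; move: b_gt; lra.
have [C1 [x1 [C10 x11 H1]]] := power_decay_survival a_gt0 kappa_gt0 X_tail LX_smooth.
have [C2 [x2 [C20 x21 H2]]] := power_decay_survival a_gt0 kappa_gt0 Y_tail LY_smooth.
have m0 : 0 < Num.min (alphaX / 2) eta by rewrite lt_min eta0 divr_gt0.
have [y1 y11 S1] := log_power_small C10 m0.
have [y2 y21 S2] := log_power_small C20 eta0.
pose x := Num.max (Num.max x1 x2) (Num.max y1 y2).
have [x1x x2x y1x y2x] : [/\ x1 <= x, x2 <= x, y1 <= x & y2 <= x].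
  by split; rewrite /x !le_max lexx ?orbT.
have x_gt1 : 1 < x by exact: lt_le_trans x11 _.
have x_gt0 : 0 < x by lra.
have eps t : x <= t -> [/\ C1 / ln t `^ kappa <= alphaX / 2,
    C1 / ln t `^ kappa <= eta & C2 / ln t `^ kappa <= eta].
  move=> xt; have := S1 t (le_trans y1x xt); rewrite le_min => /andP[-> ->].
  by rewrite S2// (le_trans y2x).
have epos (C t : R) : 0 <= C -> 0 <= C / ln t `^ kappa.
  by move=> ?; rewrite divr_ge0// powR_ge0.
pose F := survival (X 0%N); pose G := survival (Y 0%N).
have D1 t : x <= t -> power_decay F alphaX (C1 / ln t `^ kappa) t.
  by move=> xt; apply: H1; exact: le_trans xt.
have D2 t : x <= t -> power_decay G alphaY (C2 / ln t `^ kappa) t.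
  by move=> xt; apply: H2; exact: le_trans xt.
have lower (S : R -> R) (alpha e t u : R) : power_decay S alpha e t ->
    e <= eta -> 0 < t -> t <= u -> S t * expR (- (alpha + eta) * ln (u / t)) <= S u.
  move=> D ee t0 tu; have [S0 lo _] := D t u (lexx _) tu; apply: le_trans lo.
  rewrite ler_pM2l// ler_expR ler_wpM2r ?lerN2 ?lerD2l//.
  by rewrite ln_ge0// ler_pdivlMr// mul1r.
have ln2 : 0 < ln 2 :> R by rewrite ln_gt0// ltr1n.
(* The proportion of the data beyond [t] that fall before [2 * t], at least. *)
pose cc := 1 - expR (- (alphaX / 2) * ln 2).
have cc0 : 0 < cc.
  rewrite subr_gt0 -[ltRHS]expR0 ltr_expR mulNr oppr_lt0.
  by rewrite mulr_gt0// divr_gt0.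
have [Fx0 _ _] := D1 x (lexx x) x x (lexx x) (lexx x).
have [Gx0 _ _] := D2 x (lexx x) x x (lexx x) (lexx x).
exists (2 * C1 / alphaX), (cc * expR (- (alphaY + eta) * ln 2)),
  (F x * G x * expR (b * ln x)), (x + 1); split.
- by rewrite divr_ge0 ?mulr_ge0// ltW.
- by rewrite mulr_gt0 ?expR_gt0.
- by rewrite !mulr_gt0 ?expR_gt0.
- by lra.
move=> t xt; have xt' : x < t by lra.
have t0 : 0 < t by lra.
have [e1 e1' e2] := eps t (ltW xt').
have [f1 f1' f2] := eps x (lexx x).
have D1t := D1 t (ltW xt'); have D2t := D2 t (ltW xt').
have cl1 u : t <= u -> (distribution P (X 0%N) `[u, +oo[ = (F u)%:E)%E.
  move=> tu; apply: (survival_closed x_gt0 _ (D1 x (lexx x))).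
    by rewrite addr_ge0 ?epos// ltW.
  exact: lt_le_trans tu.
have cl2 : (distribution P (Y 0%N) `[t, +oo[ = (G t)%:E)%E.
  apply: (survival_closed x_gt0 _ (D2 x (lexx x))) => //.
  by rewrite addr_ge0 ?epos// ltW.
have e10 := epos C1 t C10.
have [Ft0 _ _] := D1t t t (lexx t) (lexx t).
have [Gt0 _ _] := D2t t t (lexx t) (lexx t).
have pE : \int[law]_z atrisk t z = F t * G t := mean_atrisk cl1 cl2.
split.
- have := score_bias (Y 0%N) t0 alphaX_gt0 e10 e1 D1t cl1.
  rewrite (_ : 2 * (C1 / ln t `^ kappa) / alphaX = 2 * C1 / alphaX / ln t `^ kappa)//.
  by rewrite !mulrA mulrAC.
- rewrite pE; have := mean_failure_ge (Y 0%N) t0 alphaX_gt0 e1 D1t cl1.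
  apply: le_trans; rewrite -/cc -/F -/G.
  have t2t : t <= 2 * t by rewrite ler_peMl ?ler1n// ltW.
  have := lower G alphaY _ t (2 * t) D2t e2 t0 t2t.
  rewrite mulfK ?gt_eqF// => h.
  have : cc * F t * (G t * expR (- (alphaY + eta) * ln 2)) <= cc * F t * G (2 * t).
    by rewrite ler_wpM2l// mulr_ge0// ltW.
  by apply: le_trans; rewrite le_eqVlt; apply/orP; left; apply/eqP; ring.
- rewrite pE.
  have hF := lower F alphaX _ x t (D1 x (lexx x)) f1' x_gt0 (ltW xt').
  have hG := lower G alphaY _ x t (D2 x (lexx x)) f2 x_gt0 (ltW xt').
  have : F x * expR (- (alphaX + eta) * ln (t / x)) *
      (G x * expR (- (alphaY + eta) * ln (t / x))) <= F t * G t.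
    by apply: ler_pM => //; rewrite mulr_ge0 ?expR_ge0// ltW.
  apply: le_trans; rewrite /powR gt_eqF// [leRHS]mulrACA -expRD -[leLHS]mulrA -expRD.
  rewrite ler_pM2l ?mulr_gt0// ler_expR ln_div ?posrE// /eta.
  by rewrite le_eqVlt; apply/orP; left; apply/eqP; field.
- exact: (exp_moment_score (Y 0%N) t0 alphaX_gt0 e1 D1t).
Qed.

End population.

(** * The estimation error as a function of the fluctuations *)

Section error_identity.
Context {R : realType} d (T : measurableType d) (P : probability T R)
  (X Y : nat -> {RV P >-> R}).

Definition sample_mean (f : R * R -> R) n w : R := n%:R^-1 * pair_sum X Y f n w.

Lemma phatE n t w : phat X Y n t w = sample_mean (atrisk t) n w.
Proof. by []. Qed.

Lemma qhatE n t w : qhat X Y n t w = sample_mean (failure t) n w.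
Proof. by []. Qed.

Lemma sample_mean_score alpha n t w : sample_mean (score alpha t) n w
  = alpha * sample_mean (logexcess t) n w - sample_mean (failure t) n w.
Proof.
rewrite /sample_mean /pair_sum sumrB mulrBr; congr (_ - _).
by rewrite -mulr_sumr mulrCA.
Qed.

(** Subtracting the target from a ratio of sample means leaves the sample mean
of the score, divided by that of the failures. *)
Lemma gammahat_errorE alpha n t s h w : 0 < alpha -> 0 < t -> 0 < s -> 0 < h ->
  gammahat X Y n t s h w - alpha^-1 =
  if (s <= phat X Y n t w) && (h <= qhat X Y n t w / phat X Y n t w)
  then sample_mean (score alpha t) n w / (alpha * qhat X Y n t w)
  else - alpha^-1.
Proof.
move=> alpha0 t0 s0 h0; rewrite /gammahat /rhohat zetahatE//.
set p := phat _ _ _ _ _; set q := qhat _ _ _ _ _.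
have [sp|_] := leP s p => /=; last first.
  by rewrite !mulr0 leNgt h0 /= mulr0 sub0r.
rewrite mulr1; have [hq|_] := leP h (q / p); last by rewrite mulr0 sub0r.
have p0 : 0 < p by exact: lt_le_trans sp.
have q0 : 0 < q by rewrite -(pmulr_lgt0 _ (_ : 0 < p^-1)) ?invr_gt0// (lt_le_trans h0).
rewrite sample_mean_score -qhatE -/q mulr1 mul1r.
have -> : \sum_(i < n) ln (obs X Y i w / t) * (t <= obs X Y i w)%R%:R
    = pair_sum X Y (logexcess t) n w by [].
rewrite /sample_mean invfM; set L := n%:R^-1; set S := pair_sum _ _ _ _ _.
have [pn0 qn0 an0] : [/\ p != 0, q != 0 & alpha != 0] by rewrite !gt_eqF.
by field; rewrite pn0 qn0 an0.
Qed.

End error_identity.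

Section error_bound.
Context {R : realType}.
Implicit Types (a b p q : R).

(** Here [n] is the square root of the sample size, [a], [b], [V] are the sample
means of the at-risk indicator, the failure indicator and the score, with
expectations [p], [q], [v], and [W] bounds their scaled deviations. Deviations up to
[A / 2] leave the denominators of the order of their expectations. *)
Lemma error_bound (alpha n p q v a b V s h del A lam K : R) (M : nat) (W : R) :
  0 < alpha -> 1 <= n -> 0 < p -> 0 < q <= 1 -> 0 < s -> 0 < h -> h * s <= 1 ->
  0 < A -> A <= n * p -> A <= n * q -> 2 * s <= p -> h * (3 * p) <= q ->
  0 <= del -> `|v| <= del * q ->
  0 <= W -> n * `|a - p| <= W -> n * `|b - q| <= W -> n * `|V - v| <= 4 * W ->
  0 <= lam -> 0 <= K -> del <= K * lam -> del <= K -> A^-1 <= lam ->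
  (h * s)^-1 * (2 / A) ^+ M <= lam ->
  `|if (s <= a) && (h <= b / a) then V / (alpha * b) else - alpha^-1|
    <= (3 * K + 13) / alpha * lam * (1 + W) ^+ M.+1.
Proof.
move=> al0 n1 p0 /andP[q0 q1] s0 h0 hs1 A0 Ap Aq sp hq del0 vdel W0 Wa Wb Wv
  lam0 K0 delK delK' Alam hsM.
have n0 : 0 < n by lra.
have hs0 : 0 < h * s by rewrite mulr_gt0.
have W1 : 1 <= 1 + W by lra.
have W1M k : 1 <= (1 + W) ^+ k by exact: exprn_ege1.
have VW : n * `|V| <= n * (del * q) + 4 * W.
  have : `|V| <= `|v| + `|V - v|.
    by rewrite (le_trans _ (ler_normD _ _))// addrC subrK.
  have := normr_ge0 (V - v); nra.
(* On the typical event the denominators are at least half their mean. *)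
have [good|bad] := leP (2 * W) A.
  have hp : n * `|a - p| <= n * p / 2 by lra.
  have hq' : n * `|b - q| <= n * q / 2 by lra.
  have {}hp : `|a - p| <= p / 2 by move: hp; rewrite -mulrA ler_pM2l.
  have {}hq' : `|b - q| <= q / 2 by move: hq'; rewrite -mulrA ler_pM2l.
  have /andP[ap1 ap2] : - (p / 2) <= a - p <= p / 2 by rewrite -ler_norml.
  have /andP[bq1 bq2] : - (q / 2) <= b - q <= q / 2 by rewrite -ler_norml.
  have a0 : 0 < a by lra.
  have b0 : 0 < b by lra.
  have -> : (s <= a) && (h <= b / a).
    apply/andP; split; first by lra.
    by rewrite ler_pdivlMr//; nra.
  rewrite /= normrM normfV (gtr0_norm (mulr_gt0 al0 b0)).
  rewrite ler_pdivrMr ?mulr_gt0//.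
  set B := (3 * K + 13) / alpha * lam * (1 + W) ^+ M.+1.
  have -> : B * (alpha * b) = (3 * K + 13) * lam * (1 + W) ^+ M.+1 * b.
    by rewrite /B; field; rewrite gt_eqF.
  have V1 : `|V| <= (2 * K + 8 * W) * lam * b.
    have lamA : 1 <= lam * A by rewrite -ler_pdivrMr// div1r.
    have lamq : 1 <= lam * (n * q) by nra.
    have h1 : 4 * W <= 4 * W * (lam * (n * q)) by nra.
    have h2 : n * `|V| <= n * ((K + 4 * W) * lam * q) by nra.
    rewrite ler_pM2l// in h2.
    have : 0 <= (K + 4 * W) * lam by rewrite mulr_ge0// addr_ge0// mulr_ge0.
    nra.
  apply: (le_trans V1); rewrite ler_pM2r// -mulrA [lam * _]mulrC mulrA ler_wpM2r//.
  have : 1 + W <= (1 + W) ^+ M.+1 by rewrite exprS; have := W1M M; nra.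
  nra.
(* Otherwise the bound of [b] from below by the truncation is enough, at the
   cost of a factor that the powers of [W] outweigh. *)
have bM : 1 <= (2 / A) ^+ M * W ^+ M.
  rewrite -exprMn; apply: exprn_ege1.
  by rewrite mulrAC ler_pdivlMr// mul1r ltW.
have WM0 : 0 <= W ^+ M by exact: exprn_ge0.
have hsW : (h * s)^-1 <= lam * W ^+ M.
  have : (h * s)^-1 * ((2 / A) ^+ M * W ^+ M) <= lam * W ^+ M.
    by rewrite mulrA ler_wpM2r.
  by apply: le_trans; rewrite ler_peMr// invr_ge0 ltW.
have WM : W ^+ M <= (1 + W) ^+ M by rewrite lerXn2r ?nnegrE//; lra.
have lW : lam * W ^+ M <= lam * (1 + W) ^+ M by rewrite ler_wpM2l.
have hs1' : 1 <= (h * s)^-1 by rewrite -[1]invr1 lef_pV2 ?posrE.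
rewrite exprS.
have -> : (3 * K + 13) / alpha * lam * ((1 + W) * (1 + W) ^+ M)
    = (3 * K + 13) * (1 + W) * (lam * (1 + W) ^+ M) / alpha by ring.
have Z1 : 1 <= lam * (1 + W) ^+ M by apply: le_trans lW; exact: le_trans hsW.
have hsZ : (h * s)^-1 <= lam * (1 + W) ^+ M by exact: le_trans lW.
move: Z1 hsZ; set Z := lam * _ => Z1 hsZ.
case: ifP => [/andP[sa hb]|_]; last first.
  rewrite normrN gtr0_norm ?invr_gt0// ler_pdivlMr// mulVf ?gt_eqF//.
  have : 1 <= (3 * K + 13) * (1 + W) by nra.
  nra.
have a0 : 0 < a by lra.
have hsb : h * s <= b.
  by move: hb; rewrite ler_pdivlMr//; apply: le_trans; rewrite ler_pM2l.
have b0 : 0 < b by lra.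
have V1 : `|V| <= K + 4 * W.
  have dq : del * q <= K by nra.
  have : n * `|V| <= n * (K + 4 * W).
    have : n * (del * q) <= n * K by rewrite ler_pM2l.
    have : 4 * W <= n * (4 * W) by rewrite ler_peMl// mulr_ge0.
    lra.
  by rewrite ler_pM2l.
rewrite normrM normfV (gtr0_norm (mulr_gt0 al0 b0)).
rewrite [alpha * b]mulrC invfM mulrA ler_pM2r ?invr_gt0//.
have bi : b^-1 <= (h * s)^-1 by rewrite lef_pV2 ?posrE.
have bi0 : 0 < b^-1 by rewrite invr_gt0.
have : `|V| / b <= (K + 4 * W) * Z.
  by apply: ler_pM => //; [exact: ltW|exact: le_trans hsZ].
move/le_trans; apply; rewrite ler_wpM2r//; [by apply: le_trans Z1|nra].
Qed.

(** Since [1 + W <= k * expR (W / k)]. *)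
Lemma power_le_exp (k W : R) : 1 <= k -> 0 <= W ->
  (1 + W) `^ k <= k `^ k * expR W.
Proof.
move=> k1 W0; have k0 : 0 < k by lra.
have -> : expR W = expR (W / k) `^ k.
  by rewrite /powR gt_eqF ?expR_gt0// expRK mulrC divfK// gt_eqF.
rewrite -powRM ?expR_ge0 ?(ltW k0)//.
apply: ge0_ler_powR; rewrite ?nnegrE ?mulr_ge0 ?expR_ge0 ?(ltW k0)//; first by lra.
have := expR_ge1Dx (W / k).
have : W / k * k = W by rewrite divfK// gt_eqF.
have : 0 <= W / k by rewrite divr_ge0// ltW.
nra.
Qed.

End error_bound.

(** * Norms and growth rates *)

Section norm_bound.
Context {R : realType} d (T : measurableType d) (P : probability T R).

(** Integrals of nonnegative functions are suprema over simple functions, hence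
monotone even where the smaller function is not known to be measurable. *)
Lemma le_integral_majorant (f g : T -> \bar R) : (forall w, 0 <= f w)%E ->
  (forall w, f w <= g w)%E -> (\int[P]_w f w <= \int[P]_w g w)%E.
Proof.
move=> f0 fg; have g0 w : (0 <= g w)%E by exact: le_trans (f0 w) (fg w).
rewrite !ge0_integralTE//; apply: ereal_sup_le => _ [h hf <-].
by exists h => // w; exact: le_trans (hf w) (fg w).
Qed.

Lemma Lnorm_le_power (f g : T -> R) (r c B : R) : 0 < r -> 0 <= c ->
  measurable_fun setT g -> (forall w, 0 <= g w) ->
  (forall w, `|f w| `^ r <= c `^ r * g w) -> (\int[P]_w (g w)%:E <= B%:E)%E ->
  ('N[P]_(r%:E)[EFin \o f] <= (c * B `^ r^-1)%:E)%E.
Proof.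
move=> r0 c0 mg g0 fg gB; rewrite unlock /=.
have B0 : 0 <= B.
  by rewrite -lee_fin; apply: le_trans gB; apply: integral_ge0 => w _; rewrite lee_fin.
have h : (\int[P]_w (`|(f w)%:E| `^ r) <= (c `^ r * B)%:E)%E.
  apply: (@le_trans _ _ (\int[P]_w ((c `^ r)%:E * (g w)%:E))%E).
    apply: le_integral_majorant => w; first exact: poweR_ge0.
    by rewrite -EFinM lee_fin.
  rewrite ge0_integralZl//.
  - by rewrite EFinM lee_wpmul2l// lee_fin powR_ge0.
  - exact/measurable_EFinP.
  - by move=> w _; rewrite lee_fin.
  - by rewrite lee_fin powR_ge0.
have i0 : (0 <= \int[P]_w (`|(f w)%:E| `^ r))%E.
  by apply: integral_ge0 => w _; exact: poweR_ge0.
have -> : c * B `^ r^-1 = (c `^ r * B) `^ r^-1.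
  by rewrite powRM ?powR_ge0// -powRrM mulfV ?gt_eqF// powRr1.
rewrite -poweR_EFin; apply: gt0_ler_poweR => //.
- by rewrite invr_ge0 ltW.
- by rewrite in_itv/= i0 leey.
- by rewrite in_itv/= leey andbT lee_fin mulr_ge0 ?powR_ge0.
Qed.

End norm_bound.

Section growth.
Context {R : realType}.

Lemma near_natr_ge (D : R) : \forall n \near \oo, D <= n%:R.
Proof. exact: nbhs_infty_ger. Qed.

Lemma near_power_ge (theta D : R) : 0 < theta ->
  \forall n \near \oo, D <= n%:R `^ theta.
Proof.
move=> th0; pose D' := Num.max D 0.
apply: filterS (near_natr_ge (D' `^ theta^-1)) => n hn.
have D'0 : 0 <= D' by rewrite le_max lexx orbT.
apply: (@le_trans _ _ D'); first by rewrite le_max lexx.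
have thn : theta != 0 by rewrite gt_eqF.
rewrite [leLHS](_ : _ = (D' `^ theta^-1) `^ theta); last by rewrite -powRrM mulVf// powRr1.
by apply: ge0_ler_powR; rewrite ?nnegrE ?powR_ge0 ?(ltW th0).
Qed.

Lemma near_ln_ge (D : R) : \forall n \near \oo, D <= ln n%:R.
Proof.
apply: filterS (near_natr_ge (expR D)) => n hn.
rewrite -[leLHS]expRK ler_ln ?posrE ?expR_gt0//.
exact: lt_le_trans (expR_gt0 _) hn.
Qed.

Lemma near_lnln_ge (D : R) : \forall n \near \oo, D <= ln (ln n%:R).
Proof.
apply: filterS (near_ln_ge (expR D)) => n hn.
rewrite -[leLHS]expRK ler_ln ?posrE ?expR_gt0//.
exact: lt_le_trans (expR_gt0 _) hn.
Qed.

(** The inequality [ln y <= y] at [y = x `^ u]. *)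
Lemma ln_power_le (x u : R) : 0 < x -> 0 < u -> ln x <= u^-1 * x `^ u.
Proof.
move=> x0 u0; have h : ln (x `^ u) <= x `^ u.
  by apply/ltW/ln_sublinear/powR_gt0.
by rewrite ler_pdivlMl// -ln_powR.
Qed.

Lemma near_ln_power_le (theta e D : R) : 0 < theta -> 0 < e -> 0 <= D ->
  \forall n \near \oo, D * ln n%:R `^ e <= n%:R `^ theta.
Proof.
move=> th0 e0 D0; pose u := theta / (2 * e).
have u0 : 0 < u by rewrite divr_gt0// mulr_gt0.
have th2 : 0 < theta / 2 by rewrite divr_gt0.
near=> n.
have n0 : 0 < n%:R :> R.
  by apply: (@lt_le_trans _ _ 1) => //; near: n; exact: near_natr_ge.
have l0 : 0 <= ln n%:R :> R by near: n; exact: near_ln_ge.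
have big : D * (u^-1) `^ e <= n%:R `^ (theta / 2) by near: n; exact: near_power_ge.
have le1 : ln n%:R `^ e <= (u^-1) `^ e * n%:R `^ (theta / 2).
  have -> : n%:R `^ (theta / 2) = (n%:R `^ u) `^ e.
    by rewrite -powRrM; congr (_ `^ _); rewrite /u; field; rewrite gt_eqF.
  rewrite -powRM ?invr_ge0 ?(ltW u0) ?powR_ge0//.
  by apply: ge0_ler_powR; rewrite ?nnegrE ?(ltW e0) ?mulr_ge0 ?invr_ge0 ?(ltW u0) ?powR_ge0 ?ln_power_le.
have -> : n%:R `^ theta = n%:R `^ (theta / 2) * n%:R `^ (theta / 2).
  rewrite -powRD; last by rewrite (gt_eqF n0) implybT.
  by congr (_ `^ _); field.
apply: (@le_trans _ _ (D * ((u^-1) `^ e * n%:R `^ (theta / 2)))).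
  by rewrite ler_wpM2l.
by rewrite mulrA ler_wpM2r// powR_ge0.
Unshelve. all: by end_near. Qed.

End growth.

(** * The norm of the error *)

Section growth_regime.
Context {R : realType}.

(** At the threshold [t], the lower bound [c1 * t `^ (- b)] on the at-risk
probability is of order [n `^ (- beta * b)] and exceeds [s], since [beta * b < c].
The scale [A] is [n `^ (2^-1 - c)], so a fixed power of [2 / A] compensates
[(h * s)^-1], which is [n `^ c] up to a logarithm. *)
Lemma growth_regime (beta b c kappa c0 c1 x0 : R) :
  0 < beta -> 0 < c -> beta * b < c -> c < 2^-1 -> 0 < kappa ->
  0 < c0 -> 0 < c1 ->
  exists M : nat, \forall n \near \oo,
    let t := n%:R `^ beta in let s := n%:R `^ (- c) in
    let h := (ln (ln n%:R))^-1 in let lam := (ln n%:R `^ kappa)^-1 in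
    let A := Num.sqrt n%:R * s in
    [/\ (4 <= n)%N, x0 <= t, 2 * s <= c1 * t `^ (- b) & s <= c0 * (c1 * t `^ (- b))]
    /\ [/\ 0 < h, h * 3 <= c0, h * s <= 1, A^-1 <= lam &
        1 <= ln n%:R :> R /\ (h * s)^-1 * (2 / A) ^+ M <= lam].
Proof.
move=> beta0 c_gt0 bc ch kappa0 c00 c10.
pose xi := c - beta * b; pose theta := 2^-1 - c.
have xi0 : 0 < xi by rewrite subr_gt0.
have theta0 : 0 < theta by rewrite subr_gt0.
(* The exponent is chosen so that it beats [n ^ c] with [n ^ theta] to spare. *)
pose M := Num.bound ((c + theta) / theta).
have MP : c + theta <= theta * M%:R.
  rewrite -ler_pdivrMl// mulrC ltW// archi_boundP//.
  by rewrite divr_ge0 ?(ltW theta0)// addr_ge0// ltW.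
have k10 : 0 < 1 + kappa by rewrite addr_gt0.
have M2 : 0 <= 2 ^+ M :> R by rewrite exprn_ge0.
exists M; near=> n.
set t := n%:R `^ beta; set s := n%:R `^ (- c); set h := (ln (ln n%:R))^-1.
set lam := (ln n%:R `^ kappa)^-1; set A := Num.sqrt n%:R * s.
have n4 : (4 <= n)%N by near: n; exact: nbhs_infty_ge.
have n0 : 0 < n%:R :> R by rewrite ltr0n; case: (n) n4.
have nn0 : (n%:R : R) != 0 by rewrite gt_eqF.
have n1 : 1 <= n%:R :> R by rewrite ler1n; case: (n) n4.
have s0 : 0 < s by exact: powR_gt0.
have LL1 : 1 <= ln (ln n%:R) :> R by near: n; exact: near_lnln_ge.
have LL3 : 3 / c0 <= ln (ln n%:R) :> R by near: n; exact: near_lnln_ge.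
have L1 : 1 <= ln n%:R :> R by near: n; exact: near_ln_ge.
have L0 : 0 < ln n%:R :> R by lra.
have LL0 : 0 < ln (ln n%:R) :> R by lra.
have xt : x0 <= t by rewrite /t; near: n; exact: near_power_ge.
have h0 : 0 < h by rewrite invr_gt0.
have hc : h * 3 <= c0 by rewrite mulrC ler_pdivrMr// mulrC -ler_pdivrMr.
have tE : t `^ (- b) = s * n%:R `^ xi.
  rewrite -powRrM -powRD; last by rewrite nn0 implybT.
  by congr (_ `^ _); rewrite /xi; ring.
have xi1 : 2 / c1 <= n%:R `^ xi by near: n; exact: near_power_ge.
have xi2 : (c0 * c1)^-1 <= n%:R `^ xi by near: n; exact: near_power_ge.
have AE : A = n%:R `^ theta.
  rewrite /A /s -powR12_sqrt ?(ltW n0)// -powRD//.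
  by rewrite nn0 implybT.
have A0 : 0 < A by rewrite AE powR_gt0.
have lam0 : 0 < ln n%:R `^ kappa by exact: powR_gt0.
have k1 : 1 * ln n%:R `^ kappa <= n%:R `^ theta.
  by near: n; exact: near_ln_power_le.
have k2 : 2 ^+ M * ln n%:R `^ (1 + kappa) <= n%:R `^ theta.
  by near: n; exact: near_ln_power_le.
have s1 : s <= 1.
  rewrite -[leRHS](powRr0 (n%:R : R)) /s; apply: ler_powR => //.
  by rewrite oppr_le0 ltW.
split; split => //.
- by rewrite tE [leRHS]mulrCA [2 * s]mulrC ler_pM2l// -ler_pdivrMl// mulrC.
- rewrite tE mulrA [leRHS]mulrCA -[leLHS]mulr1 ler_pM2l//.
  by rewrite -ler_pdivrMl ?mulr_gt0// mulr1.
- rewrite -[leRHS]mulr1; apply: ler_pM => //; first exact: ltW.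
    exact: ltW.
  by rewrite invf_le1.
- by rewrite lef_pV2 ?posrE// AE -[leLHS]mul1r.
- split => //; have hsE : (h * s)^-1 = ln (ln n%:R) * n%:R `^ c.
    by rewrite invfM invrK /s powRN invrK.
  have AM : (2 / A) ^+ M <= 2 ^+ M / (n%:R `^ c * n%:R `^ theta).
    rewrite expr_div_n ler_wpM2l ?exprn_ge0// lef_pV2 ?posrE ?mulr_gt0 ?exprn_gt0 ?powR_gt0//.
    rewrite -powRD; last by rewrite nn0 implybT.
    by rewrite AE -powR_mulrn ?powR_ge0// -powRrM; exact: ler_powR.
  have LLL : ln (ln n%:R) <= ln n%:R :> R by apply/ltW/ln_sublinear.
  have nc0 : 0 < n%:R `^ c by exact: powR_gt0.
  have nt0 : 0 < n%:R `^ theta by exact: powR_gt0.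
  have M0 : 0 <= 2 ^+ M / (n%:R `^ c * n%:R `^ theta) :> R.
    by rewrite divr_ge0 ?exprn_ge0 ?mulr_ge0 ?(ltW nc0) ?(ltW nt0).
  apply: (@le_trans _ _ (ln n%:R * n%:R `^ c * (2 ^+ M / (n%:R `^ c * n%:R `^ theta)))).
    rewrite hsE; apply: ler_pM => //.
    - by rewrite mulr_ge0 ?(ltW LL0) ?(ltW nc0).
    - by rewrite exprn_ge0// divr_ge0// ltW.
    - by rewrite ler_wpM2r ?(ltW nc0).
  have -> : ln n%:R * n%:R `^ c * (2 ^+ M / (n%:R `^ c * n%:R `^ theta))
      = ln n%:R * 2 ^+ M / n%:R `^ theta.
    by field; rewrite !gt_eqF.
  rewrite ler_pdivrMr// /lam ler_pdivlMl//; apply: le_trans k2.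
  rewrite powRD; last by rewrite (gt_eqF L0) implybT.
  by rewrite powRr1 ?(ltW L0)// le_eqVlt; apply/orP; left; apply/eqP; ring.
Unshelve. all: by end_near. Qed.

End growth_regime.

Lemma exp_moment_max {R : realType} d (T : measurableType d)
    (P : probability T R) (f g h : T -> R) (B : R) :
  measurable_fun setT f -> measurable_fun setT g -> measurable_fun setT h ->
  (\int[P]_w (expR (f w))%:E <= B%:E)%E ->
  (\int[P]_w (expR (g w))%:E <= B%:E)%E ->
  (\int[P]_w (expR (h w))%:E <= B%:E)%E ->
  (\int[P]_w (expR (Num.max (f w) (Num.max (g w) (h w))))%:E <= (3 * B)%:E)%E.
Proof.
move=> mf mg mh fB gB hB.
have mexp (k : T -> R) : measurable_fun setT k ->
    measurable_fun setT (fun w => (expR (k w))%:E).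
  by move=> mk; apply/measurable_EFinP; exact: measurableT_comp.
have max_le (x y z : R) :
    expR (Num.max x (Num.max y z)) <= expR x + (expR y + expR z).
  have := expR_ge0 x; have := expR_ge0 y; have := expR_ge0 z.
  by case: (leP y z) => _; [case: (leP x z)|case: (leP x y)] => _; lra.
apply: (@le_trans _ _ (\int[P]_w
    ((expR (f w))%:E + ((expR (g w))%:E + (expR (h w))%:E)))%E).
  apply: ge0_le_integral => //.
  - by apply: mexp; apply: measurable_maxr => //; exact: measurable_maxr.
  - apply: emeasurable_funD; first exact: mexp.
    by apply: emeasurable_funD; exact: mexp.
  - by move=> w _; rewrite -!EFinD lee_fin max_le.
have mgh : measurable_fun setT (fun w => (expR (g w))%:E + (expR (h w))%:E)%E.
  by apply: emeasurable_funD; exact: mexp.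
have [ef eg eh] := And3 (mexp f mf) (mexp g mg) (mexp h mh).
rewrite ge0_integralD//; last by move=> w _; rewrite -EFinD lee_fin addr_ge0 ?expR_ge0.
rewrite ge0_integralD//.
rewrite (_ : 3 * B = B + (B + B)); last by ring.
rewrite !EFinD; apply: leeD; first exact: fB.
by apply: leeD; [exact: gB|exact: hB].
Qed.

Section moments.
Context {R : realType} d (T : measurableType d) (P : probability T R)
  (X Y : nat -> {RV P >-> R}).
Hypotheses (X_id : identically_distributed X) (Y_id : identically_distributed Y)
  (XY_indep : mutually_independent (joint_family X Y)).
Local Notation law := (pair_law X Y).

Let exp_moment01 (f : R * R -> R) : measurable_fun setT f ->
  (forall z, 0 <= f z) -> (forall z, f z <= 1) ->
  (\int[law]_z (expR `|f z|)%:E <= (2 * expR 1)%:E)%E.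
Proof.
move=> mf f0 f1.
apply: (@le_trans _ _ (\int[law]_z (expR 1)%:E)%E).
  apply: ge0_le_integral => //.
    apply/measurable_EFinP; apply: measurableT_comp => //.
    exact: measurableT_comp.
  by move=> z _; rewrite lee_fin ler_expR ger0_norm.
rewrite integral_cst//.
have lawT : (law setT <= 1)%E by exact: probability_le1.
apply: (@le_trans _ _ (expR 1)%:E); last by rewrite lee_fin ler_peMl ?expR_ge0 ?ler1n.
by rewrite -[leRHS]mule1 lee_wpmul2l// lee_fin expR_ge0.
Qed.

Definition max_fluctuation (alpha t : R) n w : R :=
  Num.max `|fluctuation X Y (atrisk t) n w|
    (Num.max `|fluctuation X Y (failure t) n w|
      `|fluctuation X Y (fun z => score alpha t z / 4) n w|).

Lemma max_fluctuation_ge0 alpha t n w : 0 <= max_fluctuation alpha t n w.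
Proof. by rewrite /max_fluctuation le_max normr_ge0. Qed.

Let measurable_abs_fluctuation (f : R * R -> R) n : measurable_fun setT f ->
  measurable_fun setT (fun w => `|fluctuation X Y f n w|).
Proof.
by move=> mf; apply: measurableT_comp => //; exact: measurable_fluctuation.
Qed.

Let measurable_scaled_score alpha t :
  measurable_fun setT (fun z : R * R => score alpha t z / 4).
Proof. by apply: measurable_funM => //; exact: measurable_score. Qed.

Lemma measurable_exp_max_fluctuation alpha t n :
  measurable_fun setT (fun w => expR (max_fluctuation alpha t n w)).
Proof.
apply: measurableT_comp => //; apply: measurable_maxr.
  by apply: measurable_abs_fluctuation; exact: measurable_atrisk.
apply: measurable_maxr; apply: measurable_abs_fluctuation.
  exact: measurable_failure.
exact: measurable_scaled_score.
Qed.

Lemma exp_moment_max_fluctuation alpha t n : (4 <= n)%N ->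
  (\int[law]_z (expR `|score alpha t z / 4|)%:E <= (2 * expR 1)%:E)%E ->
  (\int[P]_w (expR (max_fluctuation alpha t n w))%:E
    <= (3 * (2 * expR (64 * (2 * expR 1 * expR (2 * expR 1)))))%:E)%E.
Proof.
move=> n4 scoreK; apply: exp_moment_max.
- by apply: measurable_abs_fluctuation; exact: measurable_atrisk.
- by apply: measurable_abs_fluctuation; exact: measurable_failure.
- exact: measurable_abs_fluctuation (measurable_scaled_score alpha t).
- exact: (exp_moment_fluctuation X_id Y_id XY_indep (measurable_atrisk t)
    (exp_moment01 (measurable_atrisk t) (atrisk_ge0 t) (atrisk_le1 t)) n4).
- exact: (exp_moment_fluctuation X_id Y_id XY_indep (measurable_failure t)
    (exp_moment01 (measurable_failure t) (failure_ge0 t) (failure_le1 t)) n4).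
- exact: (exp_moment_fluctuation X_id Y_id XY_indep
    (measurable_scaled_score alpha t) scoreK n4).
Qed.

Lemma mean_scaled_score alpha t :
  (\int[law]_z (expR `|score alpha t z / 4|)%:E <= (2 * expR 1)%:E)%E ->
  \int[law]_z (score alpha t z / 4) = (\int[law]_z score alpha t z) / 4.
Proof.
move=> scoreK.
have i4 := integrable_of_exp (measurable_scaled_score alpha t) scoreK.
have -> : \int[law]_z score alpha t z = \int[law]_z (4 * (score alpha t z / 4)).
  by apply: eq_Rintegral => z _; field.
by rewrite RintegralZl//; field.
Qed.

End moments.

Section error_norm.
Context {R : realType} d (T : measurableType d) (P : probability T R)
  (X Y : nat -> {RV P >-> R}).
Hypotheses (X_id : identically_distributed X) (Y_id : identically_distributed Y)
  (XY_indep : mutually_independent (joint_family X Y)).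
Local Notation law := (pair_law X Y).

Lemma mean_failure_le1 t : \int[law]_z failure t z <= 1.
Proof.
rewrite -lee_fin /Rintegral fineK; last exact: integrable_fin_num (integrable_failure _ _ _).
apply: (@le_trans _ _ (\int[law]_z 1%:E)%E).
  apply: ge0_le_integral => //.
  - by move=> z _; rewrite lee_fin failure_ge0.
  - by apply/measurable_EFinP; exact: measurable_failure.
  - by move=> z _; rewrite lee_fin failure_le1.
by rewrite integral_cst// mul1e; exact: probability_le1.
Qed.

(** By [error_bound] the power [r] of the error is at most [(1 + W) `^ (M.+1 * r)],
up to constants, for the largest fluctuation [W], and [power_le_exp] bounds this by
an exponential, of bounded expectation. *)
Lemma Lnorm_error_le (alpha t s h del lam K r : R) (M n : nat) :
  0 < alpha -> 0 < t -> 0 < s -> 0 < h -> 1 <= r -> 0 <= del -> 0 <= lam ->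
  0 <= K -> (4 <= n)%N ->
  2 * s <= \int[law]_z atrisk t z -> s <= \int[law]_z failure t z ->
  h * (3 * \int[law]_z atrisk t z) <= \int[law]_z failure t z ->
  `|\int[law]_z score alpha t z| <= del * \int[law]_z failure t z ->
  (\int[law]_z (expR `|score alpha t z / 4|)%:E <= (2 * expR 1)%:E)%E ->
  h * s <= 1 -> del <= K * lam -> del <= K ->
  (Num.sqrt n%:R * s)^-1 <= lam ->
  (h * s)^-1 * (2 / (Num.sqrt n%:R * s)) ^+ M <= lam ->
  ('N[P]_(r%:E)[EFin \o (fun w => (gammahat X Y n t s h w - alpha^-1)%R)]
   <= ((3 * K + 13) / alpha * lam *
       ((M.+1%:R * r) `^ (M.+1%:R * r) *
        (3 * (2 * expR (64 * (2 * expR 1 * expR (2 * expR 1)))))) `^ r^-1)%:E)%E.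
Proof.
move=> al0 t0 s0 h0 r1 del0 lam0 K0 n4 sp sq hpq vdel scoreK hs1 delK delK' Alam hsM.
set B := 3 * (2 * _); set k := M.+1%:R * r; set c := (3 * K + 13) / alpha * lam.
have n0 : 0 < n%:R :> R by rewrite ltr0n; case: (n) n4.
have N1 : 1 <= Num.sqrt n%:R :> R.
  by rewrite -[leLHS]sqrtr1 ler_wsqrtr// ler1n; case: (n) n4.
have N0 : 0 < Num.sqrt n%:R :> R by lra.
have r0 : 0 < r by lra.
have k1 : 1 <= k.
  have : 1 <= M.+1%:R :> R by rewrite ler1n.
  by rewrite /k; nra.
have c0 : 0 <= c by rewrite !mulr_ge0 ?invr_ge0 ?(ltW al0)// addr_ge0// mulr_ge0.
pose W := max_fluctuation X Y alpha t n.
have W0 w : 0 <= W w by exact: max_fluctuation_ge0.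
have bound w : `|gammahat X Y n t s h w - alpha^-1| <= c * (1 + W w) ^+ M.+1.
  rewrite gammahat_errorE//.
  have fluct f : Num.sqrt n%:R * `|sample_mean X Y f n w - \int[law]_z f z|
      = `|fluctuation X Y f n w|.
    by rewrite /fluctuation normrM (gtr0_norm N0).
  apply: (@error_bound _ alpha (Num.sqrt n%:R) (\int[law]_z atrisk t z)
    (\int[law]_z failure t z) (\int[law]_z score alpha t z) _ _ _ s h del
    (Num.sqrt n%:R * s)) => //.
  - by lra.
  - by rewrite mean_failure_le1 andbT; lra.
  - by rewrite mulr_gt0.
  - by rewrite ler_pM2l//; lra.
  - by rewrite ler_pM2l.
  - by rewrite phatE fluct /W /max_fluctuation le_max lexx.
  - by rewrite qhatE fluct /W /max_fluctuation !le_max lexx orbT.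
  - have -> : Num.sqrt n%:R * `|sample_mean X Y (score alpha t) n w
        - \int[law]_z score alpha t z|
      = 4 * `|fluctuation X Y (fun z => score alpha t z / 4) n w|.
      rewrite -fluct mean_scaled_score//.
      have -> : sample_mean X Y (fun z => score alpha t z / 4) n w
          = sample_mean X Y (score alpha t) n w / 4.
        by rewrite /sample_mean /pair_sum -mulr_suml mulrA.
      rewrite -mulrBl normrM normfV (gtr0_norm (_ : 0 < 4))//.
      by field.
    by rewrite ler_pM2l// /W /max_fluctuation !le_max lexx !orbT.
apply: (@Lnorm_le_power _ _ _ _ _ (fun w => k `^ k * expR (W w))) => //.
- by apply: measurable_funM => //; exact: measurable_exp_max_fluctuation.
- by move=> w; rewrite mulr_ge0 ?powR_ge0 ?expR_ge0.
- move=> w.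
  have W1 : 0 <= 1 + W w by rewrite addr_ge0.
  apply: (@le_trans _ _ ((c * (1 + W w) ^+ M.+1) `^ r)).
    apply: ge0_ler_powR; rewrite ?nnegrE ?(ltW r0)//.
    by rewrite mulr_ge0// exprn_ge0.
  rewrite powRM ?exprn_ge0// ler_wpM2l ?powR_ge0//.
  by rewrite -powR_mulrn// -powRrM; exact: power_le_exp.
- under eq_integral do rewrite EFinM.
  rewrite ge0_integralZl//.
  + rewrite EFinM; apply: lee_wpmul2l; first by rewrite lee_fin powR_ge0.
    exact: exp_moment_max_fluctuation.
  + by apply/measurable_EFinP; exact: measurable_exp_max_fluctuation.
  + by rewrite lee_fin powR_ge0.
Qed.

End error_norm.

Theorem theorem1 (R : realType) (d : measure_display) (T : measurableType d)
    (P : probability T R) (X Y : nat -> {RV P >-> R})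
    (a alphaX alphaY kappa gamma0 beta c m : R) (LX LY : R -> R)
    (a_gt0 : 0 < a) (alphaX_gt0 : 0 < alphaX) (alphaY_gt0 : 0 < alphaY)
    (X_id : identically_distributed X) (Y_id : identically_distributed Y)
    (XY_indep : mutually_independent (joint_family X Y))
    (X_tail : regularly_varying_tail (X 0%N) a alphaX LX)
    (Y_tail : regularly_varying_tail (Y 0%N) a alphaY LY)
    (kappa_gt0 : 0 < kappa)
    (LX_smooth : log_smooth a kappa LX) (LY_smooth : log_smooth a kappa LY)
    (gamma0_gt0 : 0 < gamma0)
    (gammaX_ge : 2 * gamma0 <= alphaX^-1) (gammaY_ge : 2 * gamma0 <= alphaY^-1)
    (beta_gt0 : 0 < beta) (beta_lt : beta < gamma0 / 2)
    (c_gt : beta / gamma0 < c) (c_lt : c < 2^-1)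
    (m_ge4 : 4 <= m) :
  exists C : R, \forall n \near \oo,
    ('N[P]_((m / 2)%:E)[EFin \o (fun w =>
        gammahat X Y n (n%:R `^ beta) (n%:R `^ (- c)) (ln (ln n%:R))^-1 w
         - alphaX^-1)%R]
     <= (C / ln n%:R `^ kappa)%:E)%E.
Proof.
have aX : alphaX <= (2 * gamma0)^-1.
  by rewrite -[alphaX]invrK lef_pV2 ?posrE ?invr_gt0 ?mulr_gt0.
have aY : alphaY <= (2 * gamma0)^-1.
  by rewrite -[alphaY]invrK lef_pV2 ?posrE ?invr_gt0 ?mulr_gt0.
have c_gt0 : 0 < c by apply: lt_trans c_gt; rewrite divr_gt0.
have gc : gamma0^-1 < c / beta.
  by rewrite ltr_pdivlMr// mulrC.
(* Any exponent strictly between [gamma0^-1], which is at least [alphaX + alphaY],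
   and [c / beta]. *)
pose b := (gamma0^-1 + c / beta) / 2.
have b_gt : alphaX + alphaY < b.
  have : (2 * gamma0)^-1 = gamma0^-1 / 2 by rewrite invfM mulrC.
  by rewrite /b; lra.
have bc : beta * b < c.
  have : b < c / beta by rewrite /b; lra.
  by rewrite ltr_pdivlMr// mulrC.
have [C [c0 [c1 [x0 [C_ge0 c0_gt0 c1_gt0 _ pop]]]]] :=
  population_regime a_gt0 alphaX_gt0 alphaY_gt0 X_tail Y_tail kappa_gt0
    LX_smooth LY_smooth b_gt.
have [M growth] := growth_regime x0 beta_gt0 c_gt0 bc c_lt kappa_gt0 c0_gt0 c1_gt0.
pose K := C / beta `^ kappa.
have K0 : 0 <= K by rewrite divr_ge0// powR_ge0.
exists ((3 * K + 13) / alphaX *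
  ((M.+1%:R * (m / 2)) `^ (M.+1%:R * (m / 2)) *
   (3 * (2 * expR (64 * (2 * expR 1 * expR (2 * expR 1)))))) `^ (m / 2)^-1).
apply: filterS growth => n /= [[n4 xt sp sq] [h0 hc hs Alam [L1 hsM]]].
have [vdel cp pt scoreK] := pop _ xt.
have n0 : 0 < n%:R :> R by rewrite ltr0n; case: (n) n4.
have s0 : 0 < n%:R `^ (- c) :> R by exact: powR_gt0.
have L0 : 0 < ln n%:R :> R by lra.
have lam0 : 0 < ln n%:R `^ kappa by exact: powR_gt0.
have delE : C / ln (n%:R `^ beta) `^ kappa = K * (ln n%:R `^ kappa)^-1.
  by rewrite ln_powR powRM ?(ltW beta_gt0) ?(ltW L0)// invfM mulrA.
have lam1 : (ln n%:R `^ kappa)^-1 <= 1.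
  rewrite invf_le1//; apply: le_trans (ler_powR L1 (ltW kappa_gt0)).
  by rewrite powRr0.
have p_pos : 0 < \int[pair_law X Y]_z atrisk (n%:R `^ beta) z by lra.
rewrite [X in (_ <= X%:E)%E](_ : _ = (3 * K + 13) / alphaX * (ln n%:R `^ kappa)^-1 *
  ((M.+1%:R * (m / 2)) `^ (M.+1%:R * (m / 2)) *
   (3 * (2 * expR (64 * (2 * expR 1 * expR (2 * expR 1)))))) `^ (m / 2)^-1);
  last by rewrite mulrAC.
apply: (Lnorm_error_le X_id Y_id XY_indep alphaX_gt0 _ s0 h0 _ _ _ K0 n4 _ _ _
  vdel scoreK hs) => //.
- exact: powR_gt0.
- by lra.
- by rewrite delE mulr_ge0// invr_ge0 ltW.
- by rewrite invr_ge0 ltW.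
- exact: le_trans pt.
- by apply: (le_trans sq); apply: le_trans cp; rewrite ler_pM2l.
- by apply: le_trans cp; rewrite mulrA ler_pM2r.
- by rewrite delE.
- by rewrite delE ler_piMr.
Qed.
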